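(* Let $r \ge 3$ be an integer and let $H$ be an $r$-segment hypergraph. Then $\tau^*(H) \le (r-1)\,\nu(H)$ and $\tau(H) \le (r-1)\,\nu^*(H)$.
   Context: A hypergraph $H=(V,E)$ consists of a vertex set $V$ and an edge set $E \subset 2^V$. For an integer $r \ge 2$, a hypergraph $H=(V,E)$ with $V \subset \mathbb{Z}^2$ is an $r$-segment hypergraph if (i) every edge in $E$ consists of $r$ consecutive integer points (points of $\mathbb{Z}^2$) on some line in $\mathbb{R}^2$, and (ii) every line in $\mathbb{R}^2$ contains at most one edge of $H$. The matching number $\nu(H)$ is the maximum number of pairwise disjoint edges of $H$. The covering number $\tau(H)$ is the minimum size of a set of vertices meeting every edge. A fractional matching is a function $f:E \to \mathbb{R}_{\ge 0}$ with $\sum_{e \ni v} f(e) \le 1$ for every $v \in V$, and the fractional matching number $\nu^*(H)$ is the maximum of $\sum_{e \in E} f(e)$ over all fractional matchings $f$ of $H$. A fractional cover is a function $g:V \to \mathbb{R}_{\ge 0}$ with $\sum_{v \in e} g(v) \ge 1$ for every $e \in E$, and the fractional covering number $\tau^*(H)$ is the minimum of $\sum_{v \in V} g(v)$ over all fractional covers $g$ of $H$. *)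

(* Defs.v *)
From HB Require Import structures.
From mathcomp Require Import all_boot all_order all_algebra.
From mathcomp Require Import mathcomp_extra boolp classical_sets functions.
From mathcomp Require Import cardinality reals ereal esum.

Set Implicit Arguments.
Unset Strict Implicit.
Unset Printing Implicit Defensive.

Import Order.TTheory GRing.Theory Num.Theory.

Local Open Scope classical_set_scope.
Local Open Scope card_scope.
Local Open Scope ring_scope.

Record hypergraph (T : Type) := Hypergraph {
  vertices : set T;
  edges : set (set T);
  edges_sub : forall e, edges e -> e `<=` vertices }.

(* No finiteness is assumed.  The four numbers below take values in \bar R: a
   maximum is written as a supremum, a minimum as an infimum, and a sum over a
   possibly infinite set as \esum; for a finite hypergraph these are the usual
   maxima, minima and finite sums. *)
Section Numbers.
Context {R : realType} {T : choiceType}.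
Implicit Types H : hypergraph T.

Definition matching H (M : set (set T)) : Prop :=
  M `<=` edges H /\ trivIset M id.

Definition cover H (C : set T) : Prop :=
  C `<=` vertices H /\ forall e, edges H e -> e `&` C !=set0.

Definition fractional_matching H (f : set T -> R) : Prop :=
  (forall e, edges H e -> 0 <= f e) /\
  (forall v, vertices H v ->
     (\esum_(e in [set e | edges H e /\ e v]) (f e)%:E <= 1)%E).

Definition fractional_cover H (g : T -> R) : Prop :=
  (forall v, vertices H v -> 0 <= g v) /\
  (forall e, edges H e -> (1 <= \esum_(v in e) (g v)%:E)%E).

(* If there are arbitrarily large finite matchings, the value is +oo. *)
Definition matching_number H : \bar R :=
  ereal_sup [set x | exists M n,
    [/\ matching H M, M #= `I_n & x = (n%:R)%:E]].

(* If there is no finite cover, the value is ereal_inf set0 = +oo. *)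
Definition covering_number H : \bar R :=
  ereal_inf [set x | exists C n,
    [/\ cover H C, C #= `I_n & x = (n%:R)%:E]].

Definition fractional_matching_number H : \bar R :=
  ereal_sup [set x | exists2 f, fractional_matching H f &
    x = (\esum_(e in edges H) (f e)%:E)%E].

Definition fractional_covering_number H : \bar R :=
  ereal_inf [set x | exists2 g, fractional_cover H g &
    x = (\esum_(v in vertices H) (g v)%:E)%E].

End Numbers.

Arguments matching_number R {T} H.
Arguments covering_number R {T} H.
Arguments fractional_matching_number R {T} H.
Arguments fractional_covering_number R {T} H.

Section Segments.
Variable R : realType.

Definition is_line (L : set (R * R)) : Prop :=
  exists a b c : R, (a, b) != (0, 0) /\
    L = [set p | a * p.1 + b * p.2 = c].

Definition plane_pt (z : int * int) : R * R := (z.1%:~R, z.2%:~R).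

Definition between (p q x : R * R) : Prop :=
  exists t : R, [/\ 0 <= t <= 1,
    x.1 = (1 - t) * p.1 + t * q.1 & x.2 = (1 - t) * p.2 + t * q.2].

(* Consecutive means that no integer point of L is skipped: every integer
   point of L lying between two points of e belongs to e. *)
Definition consecutive_on (r : nat) (L : set (R * R)) (e : set (int * int)) :
    Prop :=
  [/\ e #= `I_r,
      plane_pt @` e `<=` L &
      forall p q z, e p -> e q -> L (plane_pt z) ->
        between (plane_pt p) (plane_pt q) (plane_pt z) -> e z].

Definition segment_hypergraph (r : nat) (H : hypergraph (int * int)) : Prop :=
  (forall e, edges H e -> exists2 L, is_line L & consecutive_on r L e) /\
  (forall L e1 e2, is_line L -> edges H e1 -> edges H e2 ->
     plane_pt @` e1 `<=` L -> plane_pt @` e2 `<=` L -> e1 = e2).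

End Segments.

(* Main.v *)
Require Import Defs.
From HB Require Import structures.
From mathcomp Require Import all_boot all_order all_algebra.
From mathcomp Require Import zify ring lra.

(* Both inequalities are first proved for finite families and then extended by
   deleting vertices of infinite degree: edges through a common vertex are
   disjoint elsewhere, so if v has infinite degree, one of its edges avoids any
   given finite set missing v; hence deleting v lowers nu and nu* by at least 1,
   and it lowers tau and tau* by at most 1.  Without such vertices a family of
   bounded matching number is finite.

   Matchings (after Füredi).  In a minimal counterexample to
   nu* <= (r - 1) nu every edge has positive weight, every closed neighbourhood of
   an edge has weight more than r - 1, and no perturbation is possible, so there
   are at most as many edges as saturated vertices.  This makes the family
   r-regular with nu* = #edges / r.  A greedy choice as in Brooks' theorem, on the
   r(r-1)-regular intersection graph, produces either a large enough matching or
   r(r-1) pairwise meeting edges.  The latter is impossible for segments: from the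
   lexicographically least vertex v, fix two edges at v; an edge that avoids v cuts
   them at distances i and j, and i/j determines its direction, hence the edge.

   Covers.  No segment of length at least 3 is monochromatic for the colouring
   x^2 + y^2 mod 3, so a random threshold depending on the colour rounds a
   fractional cover of weight tau* to a cover of size at most (r - 1) tau*. *)

Set Implicit Arguments.
Unset Strict Implicit.
Unset Printing Implicit Defensive.

Import Order.TTheory GRing.Theory Num.Theory.

Local Open Scope ring_scope.

(** * Matchings and fractional matchings *)

Section Matchings.
Variables (I V : finType) (inc : I -> {set V}).
Implicit Types (i j : I) (v : V) (M F G : {set I}).

Definition meets (i j : I) : bool := inc i :&: inc j != set0.

Definition disjoint_edges (M : {set I}) : bool :=
  [forall i in M, forall j in M, meets i j ==> (i == j)].

Definition nu (F : {set I}) : nat :=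
  \max_(M : {set I} | (M \subset F) && disjoint_edges M) #|M|.

Definition closed_nbh (F M : {set I}) : {set I} :=
  [set j in F | [exists i in M, meets i j]].

Definition intersecting (F : {set I}) : Prop := {in F &, forall i j, meets i j}.

Lemma meetsC i j : meets i j = meets j i.
Proof. by rewrite /meets setIC. Qed.

Lemma disjoint_edgesP (M : {set I}) :
  reflect {in M &, forall i j, meets i j -> i = j} (disjoint_edges M).
Proof.
apply: (iffP idP) => [h i j iM jM m|h].
  move/forallP: h => /(_ i); rewrite iM /= => /forallP /(_ j).
  by rewrite jM m /= => /eqP.
apply/forallP => i; apply/implyP => iM; apply/forallP => j; apply/implyP => jM.
by apply/implyP => m; rewrite (h i j iM jM m).
Qed.

Lemma nu_max M F : M \subset F -> disjoint_edges M -> (#|M| <= nu F)%N.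
Proof. by move=> MF dM; apply: leq_bigmax_cond; rewrite MF. Qed.

Lemma nu_attained F :
  exists M, [/\ M \subset F, disjoint_edges M & #|M| = nu F].
Proof.
pose P M := (M \subset F) && disjoint_edges M.
have n0 : P set0.
  by rewrite /P sub0set; apply/disjoint_edgesP => i j; rewrite inE.
case: (arg_maxnP (fun M : {set I} => #|M|%N) n0) => M /andP[MF dM] Mmax.
exists M; split => //; apply/eqP; rewrite eqn_leq nu_max //=.
by apply/bigmax_leqP => N; apply: Mmax.
Qed.

Lemma nuS F G : F \subset G -> (nu F <= nu G)%N.
Proof.
move=> FG; have [M [MF dM <-]] := nu_attained F.
by apply: nu_max => //; apply: subset_trans FG.
Qed.

Hypothesis meetsxx : forall i, meets i i.

Lemma nu_union F G1 G2 : G1 \subset F -> G2 \subset F ->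
  {in G1 & G2, forall i j, ~~ meets i j} -> (nu G1 + nu G2 <= nu F)%N.
Proof.
move=> G1F G2F G12; have [M1 [M1G dM1 <-]] := nu_attained G1.
have [M2 [M2G dM2 <-]] := nu_attained G2.
have M12 i j : i \in M1 -> j \in M2 -> ~~ meets i j.
  by move=> iM jM; apply: G12; [apply: (subsetP M1G)|apply: (subsetP M2G)].
have d12 : M1 :&: M2 = set0.
  apply/setP => i; rewrite !inE; apply/negP => /andP[i1 i2].
  by move: (M12 _ _ i1 i2); rewrite meetsxx.
have <- : #|M1 :|: M2| = (#|M1| + #|M2|)%N by rewrite cardsU d12 cards0 subn0.
apply: nu_max.
  by rewrite subUset (subset_trans M1G) // (subset_trans M2G).
apply/disjoint_edgesP => i j; rewrite !inE => /orP[i1|i2] /orP[j1|j2] m.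
- exact: (disjoint_edgesP _ dM1).
- by move: (M12 _ _ i1 j2); rewrite m.
- by move: (M12 _ _ j1 i2); rewrite meetsC m.
- exact: (disjoint_edgesP _ dM2).
Qed.

Lemma nu_disjoint M : disjoint_edges M -> nu M = #|M|.
Proof.
move=> dM; apply/eqP; rewrite eqn_leq nu_max // andbT.
by apply/bigmax_leqP => N /andP[NM _]; apply: subset_leq_card.
Qed.

(** No edge outside the closed neighbourhood meets [M], so a matching found there can be added to
    [M]. *)
Lemma nu_closed_nbh F M : M \subset F -> disjoint_edges M ->
  (#|M| + nu (F :\: closed_nbh F M) <= nu F)%N.
Proof.
move=> MF dM; rewrite -(nu_disjoint dM); apply: nu_union => //.
  exact: subsetDl.
move=> i j iM; rewrite !inE => /andP[+ jF]; rewrite jF /=.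
by apply: contra => m; apply/existsP; exists i; rewrite iM.
Qed.


(* The greedy argument of Brooks' theorem on the intersection graph. *)
Lemma greedy_nu (D : nat) (F : {set I}) :
    (forall G, G \proper F -> (#|G| <= D * nu G)%N) ->
    (forall i, i \in F -> (#|closed_nbh F [set i]| <= D.+1)%N) ->
    (forall G : {set I}, G \subset F -> intersecting G -> (#|G| < D)%N) ->
  (#|F| <= D * nu F)%N.
Proof.
move=> small nbh noI; rewrite leqNgt; apply/negP => big.
have nbhF M : closed_nbh F M \subset F by apply/subsetP => i; rewrite inE => /andP[].
have selfnbh M i : i \in F -> i \in M -> i \in closed_nbh F M.
  by move=> iF iM; rewrite inE iF /=; apply/existsP; exists i; rewrite iM meetsxx.
have [F0|/set0Pn[i0 i0F]] := eqVneq F set0; first by rewrite F0 cards0 in big.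
have restP M : M \subset F -> M != set0 -> F :\: closed_nbh F M \proper F.
  move=> MF /set0Pn[i iM]; rewrite properE subsetDl /=; apply/subsetPn; exists i.
    exact: (subsetP MF).
  by rewrite inE selfnbh // (subsetP MF).
(* By [small], at most [D * (nu F - #|M|)] edges lie outside the neighbourhood of [M]; as [F]
   violates the bound, the neighbourhood has more than [D * #|M|] edges. *)
have bigN M : M \subset F -> M != set0 -> disjoint_edges M ->
    (D * #|M| < #|closed_nbh F M|)%N.
  move=> MF M0 dM; have := nu_closed_nbh MF dM; have := small _ (restP _ MF M0).
  rewrite cardsD (setIidPr (nbhF M)) => h1 h2.
  have h3 := leq_mul (leqnn D) h2.
  have := leq_ltn_trans h3 big; rewrite mulnDr => h4.
  rewrite -(ltn_add2r (#|F| - #|closed_nbh F M|)) subnKC ?subset_leq_card //.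
  by apply: leq_ltn_trans h4; rewrite leq_add2l.
have dj1 i : disjoint_edges [set i].
  by apply/disjoint_edgesP => a b; rewrite !inE => /eqP -> /eqP ->.
(* If every closed neighbourhood is all of [F], then [F] is intersecting and has fewer than [D]
   edges. *)
have [/forall_inP allF|] := boolP [forall i in F, closed_nbh F [set i] == F].
  have /(noI _ (subxx F)) : intersecting F.
    move=> i j iF jF; have := jF; rewrite -{1}(eqP (allF _ iF)) inE jF /=.
    by case/existsP => a; rewrite inE => /andP[/eqP->].
  have : (0 < nu F)%N.
    by apply: leq_trans (nu_max _ (dj1 i0)); rewrite ?cards1 ?sub1set.
  by move=> nu0; rewrite ltnNge (leq_trans _ (ltnW big)) // leq_pmulr.
case/forall_inPn => i1 i1F nF1.
(* Together with [bigN], the size condition makes the neighbourhood exactly one larger than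
   [D * #|M|]; the last condition leaves edges by which to extend [M]. *)
pose good (M : {set I}) := [&& M \subset F, M != set0, disjoint_edges M,
  (#|closed_nbh F M| <= (D * #|M|).+1)%N & closed_nbh F M != F].
have good1 : good [set i1].
  rewrite /good sub1set i1F dj1 nF1 cards1 muln1 nbh // !andbT /=.
  by apply/set0Pn; exists i1; rewrite inE.
case: (arg_maxnP (fun M : {set I} => #|M|%N) good1) => M /and5P[MF M0 dM leM nFM] Mmax.
have eM : #|closed_nbh F M| = (D * #|M|).+1.
  by apply/eqP; rewrite eqn_leq leM bigN.
set N := closed_nbh F M in eM nFM; set Q := F :\: N.
have QF : Q \subset F by apply: subsetDl.
have Qp : Q \proper F by apply: restP.
have cQ : (#|Q| + #|N| = #|F|)%N.
  by rewrite /Q cardsD (setIidPr (nbhF M)) subnK // subset_leq_card.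
(* Without a meeting pair between [Q] and [N] the family splits into two proper parts whose
   matchings add up. *)
have [/exists_inP[f fQ /exists_inP[g gN fg]]|noadj] :=
    boolP [exists f in Q, exists g in N, meets f g]; last first.
  have nuNQ : (nu N + nu Q <= nu F)%N.
    apply: nu_union; [exact: nbhF|exact: QF|move=> i j iN jQ; apply: contra noadj => m].
    by apply/exists_inP; exists j => //; apply/exists_inP; exists i; rewrite // meetsC.
  have Np : N \proper F by rewrite properEneq nFM nbhF.
  move: big; rewrite ltnNge -cQ (leq_trans (leq_add (small _ Qp) (small _ Np))) //.
  by rewrite -mulnDr addnC leq_mul2l nuNQ orbT.
have fF : f \in F by apply: (subsetP QF).
have fM : f \notin M by apply: contraTN fQ => fM; rewrite inE fF andbT negbK selfnbh.
have sep h : h \in Q -> {in M, forall i, ~~ meets i h}.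
  rewrite inE => /andP[hN hF] i iM; apply: contra hN => m.
  by rewrite inE hF; apply/existsP; exists i; rewrite iM.
have djU h : h \in Q -> disjoint_edges (h |: M).
  move=> hQ; apply/disjoint_edgesP => a b; rewrite !inE.
  move=> /orP[/eqP->|aM] /orP[/eqP->|bM] // m.
  - by have := sep _ hQ _ bM; rewrite meetsC m.
  - by have := sep _ hQ _ aM; rewrite m.
  - exact: (disjoint_edgesP _ dM).
have cU : #|f |: M| = #|M|.+1 by rewrite cardsU1 fM.
have UF : f |: M \subset F by rewrite subUset sub1set fF.
have U0 : f |: M != set0 by apply/set0Pn; exists f; rewrite setU11.
have NU : closed_nbh F (f |: M) = N :|: (closed_nbh F [set f] :\: N).
  apply/setP => j; rewrite !inE; case: (j \in F) => //=; rewrite ?andbF //=.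
  have -> : [exists i in f |: M, meets i j] =
      [exists i in [set f], meets i j] || [exists i in M, meets i j].
    apply/existsP/orP => [[i]|[]/existsP[i /andP[]]].
    - by rewrite !inE => /andP[/orP[/eqP->|iM] m]; [left|right];
        apply/existsP; [exists f|exists i]; rewrite ?inE ?eqxx ?iM.
    - by rewrite inE => /eqP-> m; exists f; rewrite setU11.
    - by move=> iM m; exists i; rewrite inE iM orbT.
  by case: [exists i in M, _]; rewrite ?orbT ?orbF.
(* Since the neighbour [g] of [f] already lies in [N], adding [f] brings in at most [D] new edges
   instead of [D.+1]. *)
have cNU : (#|closed_nbh F (f |: M)| <= (D * #|M|.+1).+1)%N.
  rewrite NU; apply: leq_trans (leq_card_setU _ _).1 _.
  have gF : g \in F by apply: (subsetP (nbhF M)).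
  have : (#|closed_nbh F [set f] :\: N| < D.+1)%N.
    apply: leq_trans (nbh _ fF); apply: proper_card; rewrite properE subsetDl /=.
    apply/subsetPn; exists g; last by rewrite inE gN.
    by rewrite inE gF; apply/existsP; exists f; rewrite inE eqxx.
  by rewrite eM mulnS addSn !ltnS addnC leq_add2r.
(* By maximality of [M], the extended matching can fail to be good only because its neighbourhood is
   all of [F]. Counting then gives [nu F = #|M|.+1] and at least [D] edges in [Q]. *)
have /eqP NUF : closed_nbh F (f |: M) == F.
  apply/negPn/negP => neq; have : good (f |: M).
    by rewrite /good UF U0 djU // cU cNU.
  by move=> /Mmax /=; rewrite cU ltnn.
rewrite NUF in cNU.
have nuU : (#|M|.+1 <= nu F)%N by rewrite -cU nu_max // djU.
have D0 : (0 < D)%N.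
  by rewrite -(cards0 I) noI ?sub0set // => i j; rewrite inE.
have enu : nu F = #|M|.+1.
  apply/eqP; rewrite eqn_leq nuU andbT -(leq_pmul2l D0) -ltnS.
  exact: leq_trans big cNU.
have DQ : (D <= #|Q|)%N.
  by move: big; rewrite -cQ eM enu mulnS addnS ltnS leq_add2r.
(* Two disjoint edges of [Q] together with [M] would form a matching larger than [nu F]. *)
suff /(noI _ QF) : intersecting Q by rewrite ltnNge DQ.
move=> i j iQ jQ; apply: contraT => nij.
have : (#|i |: (j |: M)| <= nu F)%N.
  apply: nu_max.
    by rewrite !subUset !sub1set !(subsetP QF).
  apply/disjoint_edgesP => a b; rewrite !inE.
  have sepC h k : h \in Q -> k \in M -> meets h k -> False.
    by move=> hQ kM; rewrite meetsC => m; have := sep _ hQ _ kM; rewrite m.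
  have sepC' h k : h \in Q -> k \in M -> meets k h -> False.
    by move=> hQ kM m; have := sep _ hQ _ kM; rewrite m.
  move=> /or3P[/eqP->|/eqP->|aM] /or3P[/eqP->|/eqP->|bM] // m.
  - by rewrite m in nij.
  - by case: (sepC _ _ iQ bM m).
  - by rewrite meetsC m in nij.
  - by case: (sepC _ _ jQ bM m).
  - by case: (sepC' _ _ iQ aM m).
  - by case: (sepC' _ _ jQ aM m).
  - exact: (disjoint_edgesP _ dM).
have QM h : h \in Q -> h \notin M.
  by rewrite inE => /andP[hN hF]; apply: contra hN; apply: selfnbh.
have ij : i != j by apply: contra nij => /eqP->.
by rewrite !cardsU1 !inE negb_or ij !QM // enu !add1n ltnn.
Qed.

End Matchings.

(** * Fractional matchings of uniform families *)

Section Weights.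
Variables (R : realFieldType) (I V : finType) (inc : I -> {set V}) (r : nat).
Implicit Types (i j : I) (v : V) (M F G : {set I}) (w u : I -> R).
Hypothesis card_inc : forall i, #|inc i| = r.
Hypothesis r_ge2 : (2 <= r)%N.

Local Notation meets := (meets inc).
Local Notation nu := (nu inc).
Local Notation closed_nbh := (closed_nbh inc).

Lemma meetsxx i : meets i i.
Proof. by rewrite /meets setIid -card_gt0 card_inc (leq_trans _ r_ge2). Qed.

Definition degree F v : nat := #|[set i in F | v \in inc i]|.

Definition load F w v : R := \sum_(i in F | v \in inc i) w i.

Definition fractional F w : Prop :=
  (forall i, i \in F -> 0 <= w i) /\ (forall v, load F w v <= 1).

Lemma sum_setS F G w : G \subset F -> {in F, forall i, 0 <= w i} ->
  \sum_(i in G) w i <= \sum_(i in F) w i.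
Proof.
move=> GF w0; rewrite [leRHS](big_setID G) /= (setIidPr GF) lerDl.
by apply: sumr_ge0 => i; rewrite inE => /andP[_ /w0].
Qed.

Lemma loadE F w v : load F w v = \sum_(i in [set i in F | v \in inc i]) w i.
Proof. by apply: eq_bigl => i; rewrite inE. Qed.

Lemma fractionalS F G w : G \subset F -> fractional F w -> fractional G w.
Proof.
move=> GF [w0 w1]; split => [i iG|v]; first exact/w0/(subsetP GF).
apply: le_trans (w1 v); rewrite !loadE; apply: sum_setS.
  by apply/subsetP => i; rewrite !inE => /andP[/(subsetP GF)-> ->].
by move=> i; rewrite inE => /andP[/w0].
Qed.

Lemma sum_load F w : \sum_v load F w v = r%:R * \sum_(i in F) w i.
Proof.
rewrite /load (exchange_big_dep (mem F)) /= => [|v i _ /andP[]//]; rewrite mulr_sumr.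
apply: eq_bigr => i iF; rewrite (eq_bigl (mem (inc i))) => [|v]; last by rewrite iF.
by rewrite sumr_const card_inc mulr_natl.
Qed.

(** The right-hand side counts [w j] once for each common vertex of [i] and [j]: at least once for a
    neighbour [j], and [r] times for [j = i]. *)
Lemma sum_load_edge F w i : i \in F -> {in F, forall j, 0 <= w j} ->
  \sum_(j in closed_nbh F [set i]) w j + (r%:R - 1) * w i <=
  \sum_(v in inc i) load F w v.
Proof.
move=> iF w0.
have -> : \sum_(v in inc i) load F w v = \sum_(j in F) w j *+ #|inc i :&: inc j|.
  rewrite /load (exchange_big_dep (mem F)) /= => [|v j _ /andP[]//].
  apply: eq_bigr => j jF; rewrite -sumr_const; apply: eq_bigl => v.
  by rewrite inE jF.
have iN : i \in closed_nbh F [set i].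
  by rewrite inE iF; apply/exists_inP; exists i; rewrite ?inE ?meetsxx.
rewrite (bigD1 i iF) (bigD1 i iN) /= setIid card_inc.
have -> : w i *+ r = w i + (r%:R - 1) * w i.
  by rewrite mulrBl mul1r mulr_natl addrC subrK.
rewrite addrAC lerD2l.
rewrite big_mkcond [leRHS]big_mkcond /=; apply: ler_sum => j _.
change ((if (j \in closed_nbh F [set i]) && (j != i) then w j else 0) <=
  (if (j \in F) && (j != i) then w j *+ #|inc i :&: inc j| else 0)).
rewrite inE; case jF: (j \in F) => //=; case: eqP => //= _.
  by rewrite andbF.
rewrite andbT; case: ifPn => [/exists_inP[k]|_]; last by rewrite mulrn_wge0 // w0.
rewrite inE => /eqP -> m; rewrite -[leLHS]mulr1n; apply: ler_wpMn2l; first exact: w0.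
by rewrite card_gt0.
Qed.

Lemma load_cst F (c : R) v : load F (fun=> c) v = c *+ degree F v.
Proof. by rewrite loadE sumr_const. Qed.

Lemma fractional_cst F : (forall v, (degree F v <= r)%N) ->
  fractional F (fun=> r%:R^-1).
Proof.
move=> deg; split=> [i _|v]; first by rewrite invr_ge0 ler0n.
rewrite load_cst -[leLHS]mulr_natl ler_pdivrMr ?mul1r ?ler_nat //.
by rewrite ltr0n (leq_trans _ r_ge2).
Qed.

(** This is [sum_load_edge] for the constant weight 1, where the right-hand side is at most
    [r * r]. *)
Lemma card_closed_nbh F i : i \in F -> (forall v, (degree F v <= r)%N) ->
  (#|closed_nbh F [set i]| <= (r * (r - 1)).+1)%N.
Proof.
move=> iF deg.
have := @sum_load_edge F (fun=> 1) i iF (fun _ _ => ler01).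
rewrite sumr_const mulr1 => h.
have {h} : #|closed_nbh F [set i]|%:R + (r%:R - 1) <= (r * r)%:R :> R.
  apply: le_trans h _; rewrite natrM -[in X in _ <= X * _](card_inc i) mulr_natl -sumr_const.
  by apply: ler_sum => v _; rewrite load_cst ler_nat.
rewrite -lerBrDr -[in r%:R - 1](natrB _ (ltnW r_ge2)) => h.
rewrite -(ler_nat R) (le_trans h) // -natrB; last first.
  by apply: leq_trans (leq_subr _ _) (leq_pmulr _ _); rewrite (leq_trans _ r_ge2).
rewrite ler_nat; suff -> : (r * r - (r - 1) = (r * (r - 1)).+1)%N by [].
by clear -r_ge2; nia.
Qed.

Definition saturated F w : {set V} := [set v | load F w v == 1].

Lemma loadZ_add F w u (t : R) v :
  load F (fun i => w i + t * u i) v = load F w v + t * load F u v.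
Proof. by rewrite /load big_split /= mulr_sumr. Qed.

(** The vertices of [S] give fewer homogeneous equations than there are unknowns, so a nonzero
    solution exists; its sign is chosen to make the total nonnegative. *)
Lemma load_kernel F (S : {set V}) : (#|S| < #|F|)%N ->
  exists u : I -> R, [/\ exists2 i, i \in F & u i != 0,
    {in S, forall v, load F u v = 0} & 0 <= \sum_(i in F) u i].
Proof.
move=> ltSF.
pose A : 'M[R]_(#|F|, #|S|) := \matrix_(k, l) (enum_val l \in inc (enum_val k))%:R.
have kerA : kermx A != 0.
  rewrite kermx_eq0 -row_leq_rank -ltnNge.
  exact: leq_ltn_trans (rank_leq_col A) ltSF.
pose x := nz_row (kermx A).
have xA : x *m A = 0 by apply/sub_kermxP; apply: nz_row_sub.
have /rV0Pn[k0 xk0] : x != 0 by rewrite nz_row_eq0.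
suff [u [ui uS]] : exists u : I -> R, (exists2 i, i \in F & u i != 0) /\
    {in S, forall v, load F u v = 0}.
  have [u0|u0] := leP 0 (\sum_(i in F) u i); first by exists u.
  exists (fun i => - u i); split => [|v vS|]; last by rewrite sumrN oppr_ge0 ltW.
    by case: ui => i iF ui; exists i; rewrite ?oppr_eq0.
  by rewrite /load sumrN [X in - X]uS ?oppr0.
have k0F : enum_val k0 \in F by apply: enum_valP.
exists (fun i => x 0 (enum_rank_in k0F i)); split.
  by exists (enum_val k0); rewrite ?enum_valP // enum_valK_in.
move=> v vS; move: xA => /matrixP /(_ 0 (enum_rank_in vS v)); rewrite !mxE => <-.
rewrite /load big_mkcondr /= big_enum_val /=; apply: eq_bigr => k _.
rewrite mxE enum_rankK_in // enum_valK_in.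
by case: ifP; rewrite ?mulr1 ?mulr0.
Qed.

(** Moving along [u] keeps saturated vertices saturated and does not lower the total. The motion
    stops when the first further inequality becomes tight. *)
Lemma push_to_boundary F w u : fractional F w -> {in F, forall i, 0 < w i} ->
    (exists2 i, i \in F & u i != 0) ->
    {in saturated F w, forall v, load F u v = 0} -> 0 <= \sum_(i in F) u i ->
  exists w', [/\ fractional F w', \sum_(i in F) w i <= \sum_(i in F) w' i &
    (exists2 i, i \in F & w' i = 0) \/ saturated F w \proper saturated F w'].
Proof.
move=> [w0 w1] wpos [i0 i0F ui0] uS usum.
(* [act] marks the inequalities that tighten along [u]: [inl] for the sign of a weight, [inr] for
   the load at a vertex. [ratio] is the distance at which such an inequality becomes an equality. *)
pose act (k : I + V) := match k with
  inl i => (i \in F) && (u i < 0) | inr v => 0 < load F u v end.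
pose ratio (k : I + V) := match k with
  inl i => w i / - u i | inr v => (1 - load F w v) / load F u v end.
(* If [u] has no negative coordinate on [F], then [u i0] is positive and any vertex of [i0] will
   do. *)
have [k0 ak0] : exists k, act k.
  have [/exists_inP[i iF ui]|/exists_inPn nneg] := boolP [exists i in F, u i < 0].
    by exists (inl i); rewrite /act iF.
  have u0 i : i \in F -> 0 <= u i by move=> /nneg; rewrite -leNgt.
  have /card_gt0P[v vi] : (0 < #|inc i0|)%N by rewrite card_inc (leq_trans _ r_ge2).
  exists (inr v); rewrite /act /load (bigD1 i0) ?i0F //=.
  rewrite ltr_wpDr ?lt_def ?ui0 ?u0 //.
  by apply: sumr_ge0 => i /andP[/andP[/u0]].
case: (arg_minP ratio ak0) => k ak kmin.
set t := ratio k.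
have t0 : 0 <= t.
  rewrite /t; case: (k) ak => [i|v] /=.
    by case/andP=> iF ui; rewrite divr_ge0 ?w0 // oppr_ge0 ltW.
  by move=> uv; rewrite divr_ge0 ?subr_ge0 // ltW.
exists (fun i => w i + t * u i); split.
- split=> [i iF|v].
    have [ui|ui] := leP 0 (u i); first by rewrite addr_ge0 ?w0 ?mulr_ge0.
    have /kmin : act (inl i) by rewrite /act iF.
    by rewrite /= ler_pdivlMr ?oppr_gt0 // mulrN -/t -subr_ge0 opprK.
  rewrite loadZ_add; have [uv|uv] := leP (load F u v) 0.
    by rewrite -[leRHS]addr0 lerD // mulr_ge0_le0.
  have /kmin : act (inr v) by [].
  by rewrite /= ler_pdivlMr // -/t lerBrDl.
- by rewrite big_split /= -mulr_sumr lerDl mulr_ge0.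
- rewrite /t; case: k ak {kmin t t0} => [i|v] /=.
    case/andP=> iF ui; left; exists i => //.
    by rewrite invrN mulrN mulNr mulfVK ?subrr // lt_eqF.
  move=> uv; right; rewrite properE; apply/andP; split.
    apply/subsetP => v' v'S; move: (v'S); rewrite !inE loadZ_add.
    by rewrite (uS v') // mulr0 addr0.
  apply/subsetPn; exists v; rewrite inE.
    by rewrite loadZ_add divfK ?lt0r_neq0 // addrC subrK.
  by apply: contraL uv => wv; rewrite uS ?ltxx // inE.
Qed.

Lemma sum_degree F : (\sum_v degree F v = r * #|F|)%N.
Proof.
apply/eqP; rewrite -(eqr_nat R) natr_sum natrM; apply/eqP.
rewrite -[#|F|%:R]sumr_const -(sum_load F (fun=> 1)).
by apply: eq_bigr => v _; rewrite load_cst.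
Qed.

(* The third hypothesis gives [w i < 1 / (r - 1)], so a saturated vertex has
   degree at least [r]; counting incidences then forces equality everywhere. *)
Lemma regular_support F w : fractional F w -> {in F, forall i, 0 < w i} ->
    {in F, forall i, r%:R - 1 < \sum_(j in closed_nbh F [set i]) w j} ->
    (#|F| <= #|saturated F w|)%N ->
  (forall v, (degree F v <= r)%N) /\ r%:R * \sum_(i in F) w i = #|F|%:R.
Proof.
move=> [w0 w1] wpos wN leFS; set S := saturated F w in leFS *.
have r1 : 0 < r%:R - 1 :> R by rewrite subr_gt0 ltr1n.
have wi i : i \in F -> w i < (r%:R - 1)^-1.
  move=> iF; rewrite -[ltRHS]mul1r ltr_pdivlMr //.
  have := sum_load_edge iF w0; have := wN _ iF.
  have : \sum_(v in inc i) load F w v <= r%:R.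
    by rewrite -(card_inc i) -sumr_const; apply: ler_sum.
  by move=> *; lra.
have degS v : v \in S -> (r <= degree F v)%N.
  rewrite inE => /eqP lv; have : load F w v < (degree F v)%:R / (r%:R - 1).
    have [d0|/card_gt0P[i iv]] := posnP (degree F v).
      have := lv; rewrite loadE big1 => [/eqP|i]; first by rewrite eq_sym oner_eq0.
      by rewrite (cards0_eq d0) inE.
    rewrite mulrC mulr_natr -sumr_const loadE; apply: ltr_sum.
      by apply/hasP; exists i; rewrite ?mem_index_enum.
    by move=> j; rewrite inE => /andP[/wi].
  by rewrite lv ltr_pdivlMr // mul1r ltrBlDr natr1 ltr_nat.
have sumS : (\sum_(v in S) r <= \sum_(v in S) degree F v
    ?= iff [forall (v | v \in S), r == degree F v])%N.
  by apply: leqif_sum => v vS; apply/leqif_eq/degS.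
have := sum_degree F; rewrite (bigID (mem S)) /= => sumF.
have leF : (r * #|F| <= \sum_(v in S) r)%N.
  by rewrite sum_nat_const mulnC leq_mul2r leFS orbT.
have sumSE : (\sum_(v in S) r = r * #|F|)%N.
  apply/eqP; rewrite eqn_leq leF andbT (leq_trans sumS) //.
  by rewrite -sumF leq_addr.
have sum0 : (\sum_(v | v \notin S) degree F v = 0)%N.
  apply/eqP; rewrite -leqn0 -(leq_add2l (\sum_(v in S) degree F v)) sumF addn0.
  by rewrite -sumSE sumS.
have deg0 v : v \notin S -> degree F v = 0%N.
  by move: sum0 => /eqP; rewrite sum_nat_eq0 => /forall_inP h /h /eqP.
have degr v : v \in S -> r = degree F v.
  have [_] := sumS; rewrite -sumF sum0 addn0 in sumSE; rewrite sumSE eqxx.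
  by move=> /esym /forall_inP h /h /eqP.
split=> [v|].
  by have [/degr <-|/deg0 ->] := boolP (v \in S).
rewrite -sum_load (bigID (mem S)) /= [X in _ + X]big1 ?addr0 => [|v vS].
  rewrite (eq_bigr (fun=> 1)) => [|v]; last by rewrite inE => /eqP.
  rewrite sumr_const; congr _%:R; apply/eqP; rewrite eqn_leq leFS andbT.
  rewrite -(leq_pmul2l (ltnW r_ge2)) -sumSE sum_nat_const mulnC //.
rewrite loadE (cards0_eq (deg0 _ vS)) big_set0 //.
Qed.

(** Induction on the number of edges and, for a fixed family, on the number of unsaturated vertices.
    When no reduction applies, [regular_support] turns the claim into [greedy_nu] with
    [D = r * (r - 1)]. *)
Lemma nu_bound F w :
    (forall G, intersecting inc G -> (forall v, (degree G v <= r)%N) ->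
      (#|G| < r * (r - 1))%N) ->
  fractional F w -> \sum_(i in F) w i <= (r%:R - 1) * (nu F)%:R.
Proof.
move=> noI; have [n] := ubnP #|F|; elim: n F w => // n IHn F w ltF.
have [m] := ubnP #|~: saturated F w|; elim: m w => // m IHm w ltS fw.
have r1 : 0 < r%:R - 1 :> R by rewrite subr_gt0 ltr1n.
have r0 : 0 < r%:R :> R by rewrite ltr0n (leq_trans _ r_ge2).
have IH G w' : G \proper F -> fractional G w' ->
    \sum_(i in G) w' i <= (r%:R - 1) * (nu G)%:R.
  by move=> GF; apply: IHn; rewrite -ltnS (leq_trans _ ltF) // ltnS proper_card.
have drop0 w' : fractional F w' -> (exists2 i, i \in F & w' i = 0) ->
    \sum_(i in F) w' i <= (r%:R - 1) * (nu F)%:R.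
  move=> fw' [i iF wi]; rewrite (big_setD1 i) //= wi add0r.
  have ltD : F :\ i \proper F by rewrite properD1.
  apply: le_trans (IH _ _ ltD (fractionalS (proper_sub ltD) fw')) _.
  by rewrite ler_pM2l // ler_nat nuS // proper_sub.
have [w0 w1] := fw.
have [/exists_inP[i iF /eqP wi]|/exists_inPn wn0] := boolP [exists i in F, w i == 0].
  by apply: drop0 => //; exists i.
have wpos : {in F, forall i, 0 < w i} by move=> i iF; rewrite lt_def wn0 // w0.
(* Deleting a closed neighbourhood of weight at most [r - 1] lowers [nu] by at least 1. *)
have [/exists_inP[i iF wN]|/exists_inPn bigN] :=
    boolP [exists i in F, \sum_(j in closed_nbh F [set i]) w j <= r%:R - 1].
  have NF : closed_nbh F [set i] \subset F.
    by apply/subsetP => j; rewrite inE => /andP[].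
  have iN : i \in closed_nbh F [set i].
    by rewrite inE iF; apply/exists_inP; exists i; rewrite ?inE ?meetsxx.
  have ltD : F :\: closed_nbh F [set i] \proper F.
    by rewrite properE subsetDl; apply/subsetPn; exists i; rewrite // inE iN.
  rewrite (big_setID (closed_nbh F [set i])) /= (setIidPr NF).
  apply: le_trans (lerD wN (IH _ _ ltD (fractionalS (proper_sub ltD) fw))) _.
  rewrite -[X in X + _]mulr1 -mulrDr ler_pM2l // nat1r ler_nat.
  rewrite -add1n -(cards1 i); apply: nu_closed_nbh; rewrite ?sub1set //.
    exact: meetsxx.
  by apply/disjoint_edgesP => a b; rewrite !inE => /eqP-> /eqP->.
have {}bigN : {in F, forall i, r%:R - 1 < \sum_(j in closed_nbh F [set i]) w j}.
  by move=> i iF; rewrite ltNge bigN.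
have [/load_kernel[u [un0 uS usum]]|leFS] := ltnP #|saturated F w| #|F|.
  have [w' [fw' lew']] := push_to_boundary fw wpos un0 uS usum.
  case=> [w'0|ltS']; apply: le_trans lew' _; first exact: drop0.
  apply: IHm => //; rewrite -ltnS (leq_trans _ ltS) // ltnS.
  by apply: proper_card; rewrite properC.
have rE : r%:R - 1 = (r - 1)%:R :> R by rewrite natrB // ltnW.
have [deg sumw] := regular_support fw wpos bigN leFS.
rewrite -(ler_pM2l r0) sumw mulrA rE -!natrM ler_nat.
apply: greedy_nu => [i|G GF|i iF|G GF Gint].
- exact: meetsxx.
(* The constant weight [1 / r] is fractional on [G], and for it the induction hypothesis is the
   required bound on [#|G|]. *)
- have degG : fractional G (fun=> r%:R^-1 : R).
    by apply: fractionalS (proper_sub GF) _; apply: fractional_cst.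
  have := IH _ _ GF degG; rewrite sumr_const -[leLHS]mulr_natl ler_pdivrMr //.
  by rewrite [leRHS]mulrC rE mulrA -!natrM ler_nat.
- exact: card_closed_nbh.
- apply: noI => // v; apply: leq_trans (deg v); apply: subset_leq_card.
  by apply/subsetP => i; rewrite !inE => /andP[/(subsetP GF)-> ->].
Qed.
End Weights.

(** * Linear programming duality *)

Section Farkas.
Variable R : realFieldType.

(** The largest lower bound serves if there is one, otherwise the smallest upper bound, otherwise
    0. *)
Lemma exists_between (J : finType) (P Q : pred J) (l u : J -> R) :
    (forall p q, P p -> Q q -> l p <= u q) ->
  exists t, (forall p, P p -> l p <= t) /\ (forall q, Q q -> t <= u q).
Proof.
move=> lu; have [/existsP[p0 Pp0]|/existsPn P0] := boolP [exists p, P p].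
  case: (arg_maxP l Pp0) => p Pp pmax.
  by exists (l p); split => [p' /pmax|q]; [|apply: lu].
have [/existsP[q0 Qq0]|/existsPn Q0] := boolP [exists q, Q q].
  case: (arg_minP u Qq0) => q Qq qmin.
  by exists (u q); split => [p|q' /qmin //]; rewrite (negPf (P0 p)).
by exists 0; split => i; rewrite ?(negPf (P0 i)) ?(negPf (Q0 i)).
Qed.

(* Fourier-Motzkin elimination of the first variable: a pair [(p, q)] stands for
   the sum of a lower bound [p] and an upper bound [q], scaled to cancel that
   variable, or for [p] alone if [p] does not involve it. *)
Lemma farkas n (J : finType) (a : J -> 'I_n -> R) (b : J -> R) :
  (exists x : 'I_n -> R, forall j, b j <= \sum_k a j k * x k) \/
  (exists y : J -> R, [/\ forall j, 0 <= y j,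
    forall k, \sum_j y j * a j k = 0 & 0 < \sum_j y j * b j]).
Proof.
elim: n J a b => [|n IHn] J a b.
  have [/existsP[j bj]|/existsPn b0] := boolP [exists j, 0 < b j]; last first.
    by left; exists (fun=> 0) => j; rewrite big_ord0 leNgt.
  right; exists (fun j' => (j' == j)%:R); split => [j'||]; rewrite ?ler0n //.
    by case.
  by rewrite (bigD1 j) //= eqxx mul1r big1 ?addr0 // => i /negPf->; rewrite mul0r.
pose z j := a j ord0.
pose m (pq : J * J) j : R :=
  if (0 < z pq.1) && (z pq.2 < 0) then
    (j == pq.1)%:R / z pq.1 + (j == pq.2)%:R / - z pq.2
  else if z pq.1 == 0 then (j == pq.1)%:R else 0.
have sum_delta p (F : J -> R) : \sum_j (j == p)%:R * F j = F p.
  by rewrite (bigD1 p) //= eqxx mul1r big1 ?addr0 // => i /negPf->; rewrite mul0r.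
have sum_m2 p q (F : J -> R) : 0 < z p -> z q < 0 ->
    \sum_j m (p, q) j * F j = F p / z p + F q / - z q.
  move=> zp zq; rewrite /m /= zp zq /=.
  under eq_bigr do rewrite mulrDl ![_ / _ * _]mulrAC.
  by rewrite big_split /= -!mulr_suml !sum_delta.
have m0 pq j : 0 <= m pq j.
  rewrite /m; case: ifP => [/andP[zp zq]|_]; last by case: ifP; rewrite ?ler0n.
  by rewrite addr_ge0 // divr_ge0 ?ler0n ?oppr_ge0 // ltW.
have sum_m_z pq : \sum_j m pq j * z j = 0.
  case: pq => p q; have [/andP[zp zq]|/negPf nz] := boolP ((0 < z p) && (z q < 0)).
    by rewrite sum_m2 // divff ?gt_eqF // invrN mulrN divff ?lt_eqF // subrr.
  rewrite /m /= nz; case: eqP => [zp|_]; first by rewrite sum_delta.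
  by rewrite big1 // => j _; rewrite mul0r.
case: (IHn _ (fun pq k => \sum_j m pq j * a j (lift ord0 k))
             (fun pq => \sum_j m pq j * b j)) => [[x xP]|[y [y0 ya yb]]].
  left; pose s j := \sum_k a j (lift ord0 k) * x k.
  have {}xP pq : \sum_j m pq j * b j <= \sum_j m pq j * s j.
    suff <- : \sum_k (\sum_j m pq j * a j (lift ord0 k)) * x k = \sum_j m pq j * s j by [].
    under [RHS]eq_bigr do rewrite mulr_sumr.
    rewrite exchange_big /=; apply: eq_bigr => k _; rewrite mulr_suml.
    by apply: eq_bigr => j _; rewrite mulrA.
  have [t [tP tQ]] := @exists_between J (fun j => 0 < z j) (fun j => z j < 0)
    (fun j => (b j - s j) / z j) (fun j => (b j - s j) / z j)
    ltac:(move=> p q zp zq; have := xP (p, q); rewrite !sum_m2 // !mulrBl invrN !mulrN; lra).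
  exists (fun k => if unlift ord0 k is Some k' then x k' else t) => j.
  rewrite big_ord_recl unlift_none; under eq_bigr do rewrite liftK.
  rewrite -/(s j) -/(z j) -lerBlDr; have [zj|zj|zj] := ltgtP (z j) 0.
  - by rewrite mulrC -ler_ndivlMr ?tQ.
  - by rewrite mulrC -ler_pdivrMr ?tP.
  (* As [z j = 0], the diagonal pair [(j, j)] stands for the constraint [j] itself. *)
  - have := xP (j, j); rewrite /m /= zj ltxx eqxx !sum_delta mul0r; lra.
have swap (F : J -> R) :
    \sum_j (\sum_pq y pq * m pq j) * F j = \sum_pq y pq * (\sum_j m pq j * F j).
  under [RHS]eq_bigr do rewrite mulr_sumr.
  rewrite [RHS]exchange_big /=; apply: eq_bigr => j _; rewrite mulr_suml.
  by apply: eq_bigr => pq _; rewrite mulrA.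
(* A certificate for the eliminated system pulls back along [m]; the coefficient of the first
   variable cancels by [sum_m_z]. *)
right; exists (fun j => \sum_pq y pq * m pq j); split => [j|k|].
- by apply: sumr_ge0 => pq _; rewrite mulr_ge0.
- rewrite swap; case: (unliftP ord0 k) => [k'|] -> //.
  by rewrite big1 // => pq _; rewrite sum_m_z mulr0.
- by rewrite swap.
Qed.
End Farkas.

(** If no cover of weight at most [c] exists, [farkas] yields multipliers. Those of the edges,
    divided by that of the weight bound, form a fractional matching of weight above [c]. *)
Lemma fractional_cover_of_matching_bound (R : realFieldType) (I V : finType)
    (inc : I -> {set V}) (c : R) :
    (forall i, inc i != set0) ->
    (forall w : I -> R, (forall i, 0 <= w i) ->
      (forall v, \sum_(i | v \in inc i) w i <= 1) -> \sum_i w i <= c) ->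
  exists g : V -> R, [/\ forall v, 0 <= g v,
    forall i, 1 <= \sum_(v in inc i) g v & \sum_v g v <= c].
Proof.
move=> inc0 maxw.
(* [inl] indexes the weight bound, [inr (inl i)] the covering condition at [i], and [inr (inr v)]
   the sign condition at [v]. *)
pose a (j : ('I_1 + (I + V))%type) (k : 'I_#|V|) : R := match j with
  | inr (inl i) => (enum_val k \in inc i)%:R
  | inr (inr v) => (enum_val k == v)%:R
  | inl _ => -1 end.
pose b (j : ('I_1 + (I + V))%type) : R := match j with
  | inr (inl i) => 1 | inr (inr v) => 0 | inl _ => - c end.
have sumV (F : V -> R) : \sum_v F v = \sum_(k < #|V|) F (enum_val k).
  rewrite (reindex_onto enum_val enum_rank) => [|v _]; last exact: enum_rankK.
  by apply: eq_bigl => k; rewrite enum_valK eqxx.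
have sumJ (F : ('I_1 + (I + V))%type -> R) :
    \sum_j F j = F (inl ord0) + \sum_i F (inr (inl i)) + \sum_v F (inr (inr v)).
  by rewrite !big_sumType big_ord1 /= addrA.
have [[x xP]|[y [y0 ya yb]]] := farkas a b.
  have xE (f : V -> R) : \sum_k f (enum_val k) * x k = \sum_v f v * x (enum_rank v).
    by rewrite sumV; apply: eq_bigr => k _; rewrite enum_valK.
  exists (fun v => x (enum_rank v)); split => [v|i|].
  - have := xP (inr (inr v)); rewrite /= (xE (fun v' => (v' == v)%:R)).
    rewrite (bigD1 v) //= eqxx mul1r big1 ?addr0 // => v' /negPf ->.
    by rewrite mul0r.
  - have := xP (inr (inl i)); rewrite /= (xE (fun v => (v \in inc i)%:R)).
    rewrite [in X in _ -> X]big_mkcond /=; congr (is_true (_ <= _)).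
    by apply: eq_bigr => v _; case: ifP; rewrite ?mul1r ?mul0r.
  - have := xP (inl ord0); rewrite /= (xE (fun=> -1)) -mulr_sumr mulN1r lerN2.
    by [].
pose w i := y (inr (inl i)); pose y1 := y (inl ord0).
have w0 i : 0 <= w i by apply: y0.
have wv v : \sum_(i | v \in inc i) w i <= y1.
  have := ya (enum_rank v); rewrite sumJ /= enum_rankK mulrN1.
  rewrite [X in _ + X](bigD1 v) //= eqxx mulr1 [X in _ + (_ + X)]big1 => [|v']; last first.
    by rewrite eq_sym => /negPf ->; rewrite mulr0.
  have -> : \sum_i y (inr (inl i)) * (v \in inc i)%:R = \sum_(i | v \in inc i) w i.
    rewrite [RHS]big_mkcond; apply: eq_bigr => i _.
    by case: ifP; rewrite ?mulr1 ?mulr0.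
  have := y0 (inr (inr v)); rewrite -/y1; lra.
move: yb; rewrite sumJ /= -/y1 [X in _ + _ + X]big1 => [|v _]; last by rewrite mulr0.
under eq_bigr do rewrite mulr1; rewrite -/(w _) addr0 mulrN => yb.
have y10 : 0 <= y1 by apply: y0.
exfalso; have [y1p|] := ltP 0 y1.
  have := maxw (fun i => w i / y1) (fun i => divr_ge0 (w0 i) y10).
  rewrite -mulr_suml ler_pdivrMr // => h.
  suff /h : forall v, \sum_(i | v \in inc i) w i / y1 <= 1.
    by move: yb; rewrite /w; lra.
  by move=> v; rewrite -mulr_suml ler_pdivrMr // mul1r.
(* If [y1 = 0], every edge weight vanishes, because each edge contains a vertex and loads are at
   most [y1]; this contradicts [yb]. *)
move=> y1n; have y1E : y1 = 0 by apply/eqP; rewrite eq_le y10 y1n.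
move: yb; rewrite y1E mul0r oppr0 add0r big1 ?ltxx // => i _.
have /set0Pn[v vi] := inc0 i; apply/eqP; rewrite eq_le w0 andbT.
apply: le_trans y1n; apply: le_trans (wv v); rewrite (bigD1 i) //= lerDl.
by apply: sumr_ge0.
Qed.

(** * Rounding a fractional cover *)

Section Rounding.
Variable R : archiRealFieldType.

Lemma count_below (K : nat) (y : R) : 0 <= y ->
  \sum_(j < K) ((j.+1%:R <= y)%R)%:R <= y.
Proof.
move=> y0; elim: K => [|K IHK]; first by rewrite big_ord0.
rewrite big_ord_recr /=; case: (leP K.+1%:R y) => [Ky|_]; last by rewrite addr0.
apply: le_trans Ky; rewrite -natr1 lerD2r -[X in _ <= X%:R](card_ord K) -sum1_card natr_sum.
by apply: ler_sum => j _; rewrite ler_nat leq_b1.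
Qed.

(** Reversing the order of the indices gives [count_below] for [K - z + 1]. *)
Lemma count_above (K : nat) (z : R) : z <= K%:R ->
  \sum_(j < K) ((z <= j.+1%:R)%R)%:R <= K%:R - z + 1.
Proof.
move=> zK; rewrite (reindex_inj rev_ord_inj) /=.
apply: le_trans (count_below K (_ : 0 <= K%:R - z + 1)); last first.
  by rewrite addr_ge0 ?subr_ge0.
apply: ler_sum => j _; rewrite subnSK // natrB 1?ltnW // -natr1 lerD2r.
by rewrite lerBrDr addrC -lerBrDr.
Qed.

Variables (I V : finType) (inc : I -> {set V}) (r : nat) (col : V -> 'I_r) (g : V -> R).
Hypothesis card_inc : forall i, #|inc i| = r.
Hypothesis r_ge2 : (2 <= r)%N.
Hypothesis col_inc : forall i (c : 'I_r), exists2 v, v \in inc i & col v != c.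
Hypothesis g_ge0 : forall v, 0 <= g v.
Hypothesis g_cover : forall i, 1 <= \sum_(v in inc i) g v.

Let r1_gt0 : 0 < r%:R - 1 :> R.
Proof. by rewrite subr_gt0 ltr1n. Qed.

Let r_gt0 : 0 < r%:R :> R.
Proof. by rewrite ltr0n (leq_trans _ r_ge2). Qed.

(* For [a <= 1 / r] an edge disjoint from [threshold c a] would have weight less
   than [(r - 1) * ((1 - a) / (r - 1)) + a = 1], since not all of its vertices
   have colour [c].  When [c] and [a] are uniform, a vertex [v] is selected with
   probability at most [(r - 1) * g v]; below [a] runs over [j / (r * K)], and
   the discretization error vanishes as [K] grows. *)
Definition threshold (c : 'I_r) (a : R) : {set V} :=
  [set v | if col v == c then 1 - a <= (r%:R - 1) * g v else a <= g v].

Lemma threshold_cover c a i : 0 <= a -> r%:R * a <= 1 ->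
  inc i :&: threshold c a != set0.
Proof.
move=> a0 ra; apply/set0Pn; have [u ui cu] := col_inc i c.
have [/existsP //|/existsPn noT] := boolP [exists v, v \in inc i :&: threshold c a].
exfalso.
pose h v : R := if col v == c then (1 - a) / (r%:R - 1) else a.
have gh v : v \in inc i -> g v < h v.
  move=> vi; have := noT v; rewrite inE vi inE /h /=.
  by case: ifP => _; rewrite -ltNge // ltr_pdivlMr // mulrC.
have ah : a <= (1 - a) / (r%:R - 1) by rewrite ler_pdivlMr //; lra.
have := g_cover i; apply/negP; rewrite -ltNge.
apply: lt_le_trans (_ : \sum_(v in inc i) h v <= 1).
  by apply: ltr_sum => //; apply/hasP; exists u; rewrite ?mem_index_enum.
rewrite (bigD1 u) //= {1}/h (negPf cu) -lerBrDl.
apply: le_trans (_ : \sum_(v in inc i | v != u) (1 - a) / (r%:R - 1) <= _).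
  by apply: ler_sum => v _; rewrite /h; case: ifP.
rewrite (eq_bigl (mem (inc i :\ u))) => [|v]; last by rewrite !inE andbC.
rewrite sumr_const -[X in X <= _]mulr_natr (_ : #|_|%:R = r%:R - 1 :> R); last first.
  by apply: (canRL (addrK _)); rewrite natr1 -(card_inc i) (cardsD1 u (inc i)) ui.
by rewrite divfK ?gt_eqF.
Qed.

Lemma sum_threshold (K : nat) v : (0 < K)%N ->
  \sum_(j < K) \sum_c (v \in threshold c (j.+1%:R / (r * K)%:R))%:R <=
  (r * K)%:R * ((r%:R - 1) * g v) + 1.
Proof.
move=> K0; set x := g v; have x0 : 0 <= x by apply: g_ge0.
have rK0 : 0 < (r * K)%:R :> R by rewrite ltr0n muln_gt0 K0 (leq_trans _ r_ge2).
have K0R : 0 < K%:R :> R by rewrite ltr0n.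
(* At level [j.+1] the vertex is selected by its own colour when [z <= j.+1], and by each other
   colour when [j.+1 <= y]. *)
pose y := (r * K)%:R * x; pose z := (r * K)%:R * (1 - (r%:R - 1) * x).
have -> : \sum_(j < K) \sum_c (v \in threshold c (j.+1%:R / (r * K)%:R))%:R =
    \sum_(j < K) ((z <= j.+1%:R)%R)%:R + (r%:R - 1) * \sum_(j < K) ((j.+1%:R <= y)%R)%:R :> R.
  rewrite mulr_sumr -big_split /=; apply: eq_bigr => j _.
  rewrite (bigD1 (col v)) //= inE eqxx; congr (_%:R + _).
    by rewrite lerBlDr addrC -lerBlDr ler_pdivlMr // mulrC.
  transitivity (\sum_(c | c != col v) ((j.+1%:R <= y)%R)%:R : R).
    apply: eq_bigr => c cv; rewrite inE eq_sym (negPf cv) ler_pdivrMr //.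
    by rewrite mulrC.
  rewrite sumr_const -[LHS]mulr_natl; congr (_ * _).
  by rewrite cardC1 card_ord -subn1 natrB // (leq_trans _ r_ge2).
have zE : z = (r * K)%:R - (r * K)%:R * ((r%:R - 1) * x) by rewrite /z mulrBr mulr1.
(* For [x < 1 / r] one has [z > K], so the own colour of [v] never selects it and the others
   contribute at most [y] each. Otherwise the others contribute at most [K] each, and [count_above]
   bounds the own colour. *)
have [rx|rx] := ltP (r%:R * x) 1.
  rewrite big1 => [|j _].
    have := count_below K (mulr_ge0 (ltW rK0) x0); rewrite -/y.
    by rewrite -(ler_pM2l r1_gt0) /y; lra.
  suff zj : j.+1%:R < z by rewrite leNgt zj.
  apply: le_lt_trans (_ : K%:R < z); first by rewrite ler_nat.
  have : 0 < (r%:R - 1) * (K%:R * (1 - r%:R * x)) by rewrite !mulr_gt0 ?subr_gt0 ?ltr1n.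
  by rewrite zE natrM; lra.
have zK : z <= K%:R.
  have : 0 <= (r%:R - 1) * (K%:R * (r%:R * x - 1)).
    by rewrite !mulr_ge0 ?(ltW r1_gt0) ?subr_ge0.
  by rewrite zE natrM; lra.
have N2 : \sum_(j < K) ((j.+1%:R <= y)%R)%:R <= K%:R :> R.
  rewrite -[X in _ <= X%:R](card_ord K) -sum1_card natr_sum.
  by apply: ler_sum => j _; rewrite ler_nat leq_b1.
have := lerD (count_above zK) (ler_wpM2l (ltW r1_gt0) N2).
by move/le_trans; apply; rewrite zE natrM; lra.
Qed.

(** Averaging: a smallest cover is no larger than any threshold cover. If it exceeded the bound by
    [d > 0], summing over all colours and levels would give [r * K * d <= #|V|], which fails for
    large [K]. *)
Lemma rounding : exists C : {set V},
  (forall i, inc i :&: C != set0) /\ #|C|%:R <= (r%:R - 1) * \sum_v g v.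
Proof.
pose G := \sum_v g v.
pose cov (C : {set V}) := [forall i, inc i :&: C != set0].
have covT : cov [set: V].
  apply/forallP => i; rewrite setIT -card_gt0 card_inc (leq_trans _ r_ge2) //.
case: (arg_minnP (fun C : {set V} => #|C|%N) covT) => C /forallP Ccov Cmin.
exists C; split=> //; rewrite leNgt; apply/negP; rewrite -subr_gt0 -/G.
set d := #|C|%:R - _ => d0.
pose K := (Num.bound (#|V|%:R / d)).+1.
have Kd : #|V|%:R < K%:R * d.
  rewrite -ltr_pdivrMr //; apply: lt_trans (_ : (Num.bound (#|V|%:R / d))%:R < _).
    by rewrite archi_boundP // divr_ge0 // ltW.
  by rewrite ltr_nat.
have rK0 : 0 < (r * K)%:R :> R by rewrite ltr0n muln_gt0 (leq_trans _ r_ge2).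
have : \sum_(j < K) \sum_(c < r) #|C|%:R <=
    \sum_v ((r * K)%:R * ((r%:R - 1) * g v) + 1) :> R.
  have K0 : (0 < K)%N by [].
  apply: (@le_trans _ _ (\sum_v \sum_(j < K) \sum_c
      (v \in threshold c (j.+1%:R / (r * K)%:R))%:R)); last first.
    by apply: ler_sum => v _; apply: sum_threshold.
  rewrite [leRHS]exchange_big /=; apply: ler_sum => j _.
  rewrite [leRHS]exchange_big /=; apply: ler_sum => c _.
  set a := _ / _; have a0 : 0 <= a by rewrite divr_ge0 // ltW.
  have ra : r%:R * a <= 1.
    by rewrite /a mulrA -natrM ler_pdivrMr // mul1r ler_nat leq_mul2l ltn_ord orbT.
  apply: le_trans (_ : #|threshold c a|%:R <= _).
    by rewrite ler_nat Cmin //; apply/forallP => i; apply: threshold_cover.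
  rewrite -sum1_card natr_sum big_mkcond /=; apply: ler_sum => v _.
  by case: (v \in _).
apply/negP; rewrite -ltNge.
rewrite big_split /= -!mulr_sumr -/G !sumr_const !card_ord -mulrnA -[ltRHS]mulr_natl.
have -> : #|C|%:R = d + (r%:R - 1) * G by rewrite /d subrK.
have : 1 * (K%:R * d) <= r%:R * (K%:R * d).
  by rewrite ler_wpM2r ?mulr_ge0 ?(ltW d0) // ler1n (leq_trans _ r_ge2).
by rewrite natrM cardT -cardE; lra.
Qed.
End Rounding.

(** * Intersecting families of segments *)

Definition cross (u w : int * int) : int := u.1 * w.2 - u.2 * w.1.

Definition step (p d : int * int) (k : nat) : int * int :=
  (p.1 + k%:Z * d.1, p.2 + k%:Z * d.2).

(** Of [d] and [- d], for nonzero [d], exactly one qualifies; it orients a segment away from its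
    lexicographically least point. *)
Definition lex_positive (d : int * int) : bool :=
  (0 < d.1) || ((d.1 == 0) && (0 < d.2)).

(* For [r = 3], three pairwise meeting edges may each cross three edges that
   start at a common point [v], at distances [xi], [yi], [zi] from [v]; [X], [Y],
   [Z] are the determinants of the directions of these three edges. *)
Lemma three_transversals (X Y Z : int) (x1 x2 x3 y1 y2 y3 z1 z2 z3 : nat) :
    X != 0 -> Y != 0 -> Z != 0 ->
    (0 < x1 < 3)%N -> (0 < x2 < 3)%N -> (0 < x3 < 3)%N ->
    (0 < y1 < 3)%N -> (0 < y2 < 3)%N -> (0 < y3 < 3)%N ->
    [&& x1 * y2 != x2 * y1, x1 * y3 != x3 * y1 & x2 * y3 != x3 * y2]%N ->
    (0 < z1 < 3)%N -> (0 < z2 < 3)%N -> (0 < z3 < 3)%N ->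
    [&& x1 * z2 != x2 * z1, x1 * z3 != x3 * z1 & x2 * z3 != x3 * z2]%N ->
    [&& y1 * z2 != y2 * z1, y1 * z3 != y3 * z1 & y2 * z3 != y3 * z2]%N ->
    (x1 * y1)%:Z * X + (y1 * z1)%:Z * Y + (x1 * z1)%:Z * Z = 0 ->
    (x2 * y2)%:Z * X + (y2 * z2)%:Z * Y + (x2 * z2)%:Z * Z = 0 ->
    (x3 * y3)%:Z * X + (y3 * z3)%:Z * Y + (x3 * z3)%:Z * Z = 0 -> False.
Proof.
move=> X0 Y0 Z0.
have two n : (0 < n < 3)%N -> n = 1%N \/ n = 2%N by lia.
(* Each ratio condition forces the ratios 1/2, 1 and 2 to occur once each. Up to the order of the
   equations only two linear systems in [X], [Y], [Z] remain, and both are nonsingular. *)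
do 6 (case/two => ->); move=> //= _; do 3 (case/two => ->); move=> //= _ _; lia.
Qed.

Section SegmentFamilies.
Variables (I V : finType) (inc : I -> {set V}) (r : nat).
Variables (pt : V -> int * int) (P D : I -> int * int).
Implicit Types (i j e b : I) (u v : V) (F : {set I}).
Hypothesis pt_inj : injective pt.
Hypothesis inc_step : forall i v, v \in inc i ->
  exists2 k, (k < r)%N & pt v = step (P i) (D i) k.
Hypothesis step_inc : forall i k, (k < r)%N ->
  exists2 v, v \in inc i & pt v = step (P i) (D i) k.
Hypothesis D_pos : forall i, lex_positive (D i).
Hypothesis D_inj : forall i j v, v \in inc i -> v \in inc j ->
  cross (D i) (D j) = 0 -> i = j.
Hypothesis card_inc : forall i, #|inc i| = r.
Hypothesis r_ge3 : (3 <= r)%N.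

Local Notation meets := (meets inc).
Local Notation degree := (degree inc).

Let step0 p d : step p d 0 = p.
Proof. by case: p => a b; rewrite /step /= !mul0r !addr0. Qed.

(** The lexicographic minimum is not a proper step forward from any point of [S]; when [S] is the
    union of the edges, every edge through [v] must therefore start at [v]. *)
Lemma lex_min_vertex (S : {set V}) : S != set0 ->
  exists2 v, v \in S & forall u i k, u \in S -> pt v = step (pt u) (D i) k -> k = 0%N.
Proof.
case/set0Pn => v0 v0S.
case: (@arg_minP _ _ _ v0 (fun v => v \in S) (fun v => (pt v).1) v0S) => v1 v1S min1.
have v1S' : (v1 \in S) && ((pt v1).1 == (pt v1).1) by rewrite v1S eqxx.
case: (@arg_minP _ _ _ v1 (fun v => (v \in S) && ((pt v).1 == (pt v1).1))
  (fun v => (pt v).2) v1S') => v /andP[vS /eqP v1E] min2.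
exists v => // u i k uS vE.
have := D_pos i; have := min1 u uS; move: v1E; rewrite vE /step /=.
case/orP: (D_pos i) => [d1|/andP[/eqP d1 d2]] e1 le1 _; first by nia.
have /min2 : (u \in S) && ((pt u).1 == (pt v1).1) by rewrite uS -e1 d1 mulr0 addr0 /=.
by rewrite vE /step /=; nia.
Qed.

Let r_gt0 : (0 < r)%N.
Proof. exact: leq_trans r_ge3. Qed.

Section Apex.
Variables (F : {set I}) (v : V).
Hypothesis Fint : intersecting inc F.

Definition star : {set I} := [set e in F | v \in inc e].
Definition costar : {set I} := [set b in F | v \notin inc b].
Hypothesis star_start : forall e, e \in star -> P e = pt v.

(** The distance from [v] along [e] to a common point of [e] and [b]. For [e] in the star and [b] in
    the costar such a point exists, so the default 0 does not occur. *)
Definition crossing (e b : I) : 'I_r :=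
  odflt (Ordinal r_gt0)
    [pick k : 'I_r | [exists u in inc e :&: inc b, pt u == step (pt v) (D e) k]].

Lemma crossingP e b : e \in star -> b \in costar ->
  (0 < crossing e b < r)%N /\
  exists m : int, step (pt v) (D e) (crossing e b) =
    ((P b).1 + m * (D b).1, (P b).2 + m * (D b).2).
Proof.
move=> eS bC; have := eS; rewrite inE => /andP[eF ve].
have := bC; rewrite inE => /andP[bF vb].
rewrite /crossing; case: pickP => [k /exists_inP[u]|none].
  rewrite inE => /andP[ue ub] /eqP uE; split.
    rewrite ltn_ord andbT lt0n; apply: contra vb => /eqP k0.
    by rewrite (_ : v = u) //; apply: pt_inj; rewrite uE k0 step0.
  by have [k' _ uE'] := inc_step ub; exists k'; rewrite -uE uE'.
have /set0Pn[u] := Fint eF bF; rewrite inE => /andP[ue ub].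
have [k kr uE] := inc_step ue; have := none (Ordinal kr).
move/exists_inPn => /(_ u); rewrite inE ue ub => /(_ isT).
by rewrite -(star_start eS) /= uE eqxx.
Qed.

Lemma star_independent e e' : e \in star -> e' \in star -> e != e' ->
  cross (D e) (D e') != 0.
Proof.
rewrite !inE => /andP[_ ve] /andP[_ ve']; apply: contra => /eqP c0.
by apply/eqP; exact: (D_inj ve ve' c0).
Qed.

(* Equal ratios of the distances from [v] give parallel lines. *)
Lemma crossing_ratio e e' b b' : e \in star -> e' \in star -> e != e' ->
    b \in costar -> b' \in costar ->
    (crossing e b * crossing e' b' = crossing e b' * crossing e' b)%N ->
  b = b'.
Proof.
move=> eS e'S ee' bC b'C ratio; have ind := star_independent eS e'S ee'.
have [bF b'F] : b \in F /\ b' \in F by move: bC b'C; rewrite !inE => /andP[-> _] /andP[-> _].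
(* Since [b] and [b'] meet, [D_inj] reduces the claim to their being parallel. *)
have /set0Pn[u] := Fint bF b'F; rewrite inE => /andP[ub ub'].
apply: (D_inj ub ub').
have [/andP[p1 _] [m1 [h1 h1']]] := crossingP eS bC.
have [/andP[p2 _] [m2 [h2 h2']]] := crossingP e'S bC.
have [/andP[p3 _] [m3 [h3 h3']]] := crossingP eS b'C.
have [/andP[p4 _] [m4 [h4 h4']]] := crossingP e'S b'C.
move: ratio p2 p4 h1 h1' h2 h2' h3 h3' h4 h4' ind; rewrite /cross.
move: (crossing e b) (crossing e' b) (crossing e b') (crossing e' b').
move: (D e) (D e') (D b) (D b') (pt v) (P b) (P b').
move=> [E1 E2] [E'1 E'2] [B1 B2] [B'1 B'2] [v1 v2] [w1 w2] [w'1 w'2] p q p' q' /=.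
move=> /(congr1 Posz); rewrite !PoszM => ratio q0 q'0 h1 h1' h2 h2' h3 h3' h4 h4' ind.
(* Both crossing points of [b] lie on its line, so their difference is a multiple of its direction;
   the same holds for [b']. *)
have k1 : (m2 - m1) * B1 = q%:Z * E'1 - p%:Z * E1 by lra.
have k2 : (m2 - m1) * B2 = q%:Z * E'2 - p%:Z * E2 by lra.
have l1 : (m4 - m3) * B'1 = q'%:Z * E'1 - p'%:Z * E1 by lra.
have l2 : (m4 - m3) * B'2 = q'%:Z * E'2 - p'%:Z * E2 by lra.
(* These multiples are nonzero because the directions of [e] and [e'] are independent and the
   distance along [e'] is positive. *)
have nz (k x y c : int) (n : nat) : (0 < n)%N ->
    k * x = n%:Z * E'1 - c * E1 -> k * y = n%:Z * E'2 - c * E2 -> k != 0.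
  move=> n0 eq1 eq2; apply: contra ind => /eqP k0.
  have : n%:Z * (E1 * E'2 - E2 * E'1) =
    E1 * (n%:Z * E'2 - c * E2) - E2 * (n%:Z * E'1 - c * E1) by ring.
  rewrite -eq1 -eq2 k0 !mul0r !mulr0 subrr => /eqP.
  by rewrite mulf_eq0 eqz_nat gtn_eqF.
have : (m2 - m1) * (m4 - m3) * (B1 * B'2 - B2 * B'1) = 0.
  transitivity ((m2 - m1) * B1 * ((m4 - m3) * B'2) -
    (m2 - m1) * B2 * ((m4 - m3) * B'1)); first by ring.
  rewrite k1 k2 l1 l2.
  transitivity ((q%:Z * p'%:Z - p%:Z * q'%:Z) * (E1 * E'2 - E2 * E'1)); first by ring.
  by rewrite ratio mulrC [q%:Z * _]mulrC subrr mulr0.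
move/eqP; rewrite !mulf_eq0 (negPf (nz _ _ _ _ _ q0 k1 k2)).
by rewrite (negPf (nz _ _ _ _ _ q'0 l1 l2)) => /eqP.
Qed.

(** The three crossing points lie on the line of [b]. Expanding the vanishing determinant of two of
    their differences, taken relative to [v], gives this relation. *)
Lemma crossing_collinear e1 e2 e3 b : e1 \in star -> e2 \in star -> e3 \in star ->
    b \in costar ->
  (crossing e1 b * crossing e2 b)%:Z * cross (D e1) (D e2) +
  (crossing e2 b * crossing e3 b)%:Z * cross (D e2) (D e3) +
  (crossing e1 b * crossing e3 b)%:Z * cross (D e3) (D e1) = 0.
Proof.
move=> e1S e2S e3S bC.
have [_ [m1 [h1 h1']]] := crossingP e1S bC.
have [_ [m2 [h2 h2']]] := crossingP e2S bC.
have [_ [m3 [h3 h3']]] := crossingP e3S bC.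
move: h1 h1' h2 h2' h3 h3'; rewrite !PoszM /cross.
move: (crossing e1 b) (crossing e2 b) (crossing e3 b).
move: (D e1) (D e2) (D e3) (D b) (pt v) (P b)
  => [a1 a2] [b1 b2] [c1 c2] [d1 d2] [v1 v2] [w1 w2].
move=> x y z /= h1 h1' h2 h2' h3 h3'.
have k1 : y%:Z * b1 - x%:Z * a1 = (m2 - m1) * d1 by lra.
have k2 : y%:Z * b2 - x%:Z * a2 = (m2 - m1) * d2 by lra.
have l1 : z%:Z * c1 - x%:Z * a1 = (m3 - m1) * d1 by lra.
have l2 : z%:Z * c2 - x%:Z * a2 = (m3 - m1) * d2 by lra.
transitivity ((y%:Z * b1 - x%:Z * a1) * (z%:Z * c2 - x%:Z * a2) -
              (y%:Z * b2 - x%:Z * a2) * (z%:Z * c1 - x%:Z * a1)); first by ring.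
by rewrite k1 k2 l1 l2; ring.
Qed.

(** The two distances from [v] lie in [1, ..., r - 1], and by [crossing_ratio] their ratio
    determines [b]. Ratio 1 accounts for at most one edge, the off-diagonal pairs for at most
    [(r - 1) * (r - 2)]. *)
Lemma card_costar e e' : e \in star -> e' \in star -> e != e' ->
  (#|costar| <= 1 + (r - 1) * (r - 2))%N.
Proof.
move=> eS e'S ee'.
pose C0 := [set b in costar | crossing e b == crossing e' b].
pose C1 := [set b in costar | crossing e b != crossing e' b].
have -> : costar = C0 :|: C1.
  by apply/setP => b; rewrite !inE -andb_orr orbN andbT.
apply: leq_trans (leq_card_setU _ _).1 _; apply: leq_add.
  apply/card_le1_eqP => b b'; rewrite !inE => /andP[bC /eqP cb] /andP[b'C /eqP cb'].
  by apply: (crossing_ratio eS e'S ee'); rewrite ?inE // cb cb' mulnC.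
pose S : {set 'I_r} := ~: [set Ordinal r_gt0].
have cS : #|S| = (r - 1)%N by rewrite cardsC1 card_ord subn1.
have inS (k : 'I_r) : (0 < k)%N -> k \in S.
  by move=> k0; rewrite !inE -val_eqE /= -lt0n.
have -> : ((r - 1) * (r - 2) = #|setX S S :\: [set (k, k) | k in S]|)%N.
  rewrite cardsD (setIidPr _) => [|]; last first.
    by apply/subsetP => _ /imsetP[k kS ->]; rewrite inE /= kS.
  rewrite cardsX card_imset ?cS => [|k k' []//].
  by rewrite -{4}[(r - 1)%N]muln1 -mulnBr -subnDA.
have finj : {in C1 &, injective (fun b => (crossing e b, crossing e' b))}.
  move=> b b'; rewrite inE => /andP[bC _] b'C1; have := b'C1.
  rewrite inE => /andP[b'C _] [c1 c2].
  by apply: (crossing_ratio eS e'S ee' bC b'C); rewrite c1 c2.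
rewrite -(card_in_imset finj); apply: subset_leq_card.
apply/subsetP => _ /imsetP[b + ->]; rewrite inE => /andP[bC cb].
have [/andP[p1 _] _] := crossingP eS bC; have [/andP[p2 _] _] := crossingP e'S bC.
rewrite !inE /= -!in_setC1 -/S !inS // !andbT.
by apply: contra cb => /imsetP[k _ [-> ->]].
Qed.

(** Every edge meets an edge [e] through [v], so [sum_load_edge] with weight 1 bounds
    [#|F| + (r - 1)] by the degree sum over [e], where each of the other [r - 1] vertices
    contributes at most [r]. *)
Lemma star_lower_bound : v \in \bigcup_(i in F) inc i ->
  (forall u, (degree F u <= r)%N) -> (r * (r - 1) <= #|F|)%N ->
  (r - 1 <= #|star|)%N.
Proof.
case/bigcupP => e eF ve deg big.
have := @sum_load_edge rat I V inc r card_inc (ltnW r_ge3)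
  F (fun=> 1) e eF (fun _ _ => ler01).
have -> : closed_nbh inc F [set e] = F.
  apply/setP => b; rewrite inE; case bF: (b \in F) => //=.
  by apply/exists_inP; exists e; rewrite ?inE ?Fint.
rewrite sumr_const mulr1 (bigD1 v) //= load_cst => h.
have {}h : #|F|%:R + (r%:R - 1) <= (#|star| + r * (r - 1))%:R :> rat.
  apply: le_trans h _; rewrite natrD lerD //.
  apply: le_trans (_ : \sum_(u in inc e | u != v) r%:R <= _).
    by apply: ler_sum => u _; rewrite load_cst ler_nat.
  rewrite (eq_bigl (mem (inc e :\ v))) => [|u]; last by rewrite !inE andbC.
  rewrite sumr_const -[X in X <= _]mulr_natr -natrM ler_nat leq_mul2l.
  by rewrite -{2}(card_inc e) (cardsD1 v (inc e)) ve add1n subn1 leqnn orbT.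
have : (#|F| + (r - 1) <= #|star| + r * (r - 1))%N.
  by rewrite -(ler_nat rat) natrD natrB // (leq_trans _ r_ge3).
by rewrite addnC => H; rewrite -(leq_add2r (r * (r - 1))) (leq_trans _ H) // leq_add2l.
Qed.

End Apex.

(** A counterexample would have at most [r] edges through [v] and at most [1 + (r - 1) * (r - 2)]
    others, which forces [r = 3] and three edges of each kind. That case is excluded by
    [three_transversals]. *)
Lemma card_intersecting F : intersecting inc F -> (forall v, (degree F v <= r)%N) ->
  (#|F| < r * (r - 1))%N.
Proof.
move=> Fint deg; rewrite ltnNge; apply/negP => big.
have [i0 i0F] : exists i, i \in F.
  by apply/card_gt0P; apply: leq_trans big; rewrite muln_gt0 r_gt0 subn_gt0 ltnW.
have [v vS vmin] : exists2 v, v \in \bigcup_(i in F) inc i &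
    forall u i k, u \in \bigcup_(i in F) inc i -> pt v = step (pt u) (D i) k -> k = 0%N.
  apply: lex_min_vertex; apply/set0Pn; have [u ui _] := step_inc i0 r_gt0.
  by exists u; apply/bigcupP; exists i0.
have start e : e \in star F v -> P e = pt v.
  rewrite inE => /andP[eF ve]; have [k _ vE] := inc_step ve.
  have [u ue] := step_inc e r_gt0; rewrite step0 => uE.
  have uS : u \in \bigcup_(i in F) inc i by apply/bigcupP; exists e.
  by move: (vE); rewrite -uE => /(vmin _ _ _ uS) k0; rewrite vE k0 step0.
have lbs := star_lower_bound Fint vS deg big.
have ubs : (#|star F v| <= r)%N by apply: deg.
have cF : #|F| = (#|star F v| + #|costar F v|)%N.
  rewrite -cardsUI (_ : star F v :&: costar F v = set0) ?cards0 ?addn0; last first.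
    by apply/setP => i; rewrite !inE; case: (i \in F); case: (v \in _).
  congr #|pred_of_set _|; apply/setP => i; rewrite !inE.
  by case: (i \in F); case: (v \in _).
have /card_gt1P[e1 [e2 [e1S e2S e12]]] : (1 < #|star F v|)%N.
  by apply: leq_trans lbs; rewrite ltn_subRL addn1.
have := card_costar Fint start e1S e2S e12 => ubc.
have r3 : r = 3%N.
  move: lbs ubs cF ubc big r_ge3; clear.
  by move: #|_| #|_| #|_| => a b c; nia.
have c3 : (3 <= #|star F v|)%N /\ (3 <= #|costar F v|)%N.
  move: lbs ubs cF ubc big; rewrite r3; clear.
  by move: #|_| #|_| #|_| => a b c; lia.
have [/card_gt2P[a1 [a2 [a3 [[a1S a2S a3S] [a12 a23 a31]]]]]] := c3.1.
have [/card_gt2P[b1 [b2 [b3 [[b1C b2C b3C] [b12 b23 b31]]]]]] := c3.2.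
have cr a b : a \in star F v -> b \in costar F v -> (0 < crossing v a b < 3)%N.
  move=> aS bC; have [/andP[-> /leq_trans lt3] _] := crossingP Fint start aS bC.
  by rewrite lt3 // r3.
have rat a a' b b' : a \in star F v -> a' \in star F v -> b \in costar F v ->
    b' \in costar F v -> a != a' -> b != b' ->
    (crossing v a b * crossing v a' b' != crossing v a b' * crossing v a' b)%N.
  move=> aS a'S bC b'C aa'; apply: contra => /eqP.
  by move/(crossing_ratio Fint start aS a'S aa' bC b'C) ->.
have b13 : b1 != b3 by rewrite eq_sym.
have a13 : a1 != a3 by rewrite eq_sym.
apply: (@three_transversals (cross (D a1) (D a2)) (cross (D a2) (D a3)) (cross (D a3) (D a1))
  (crossing v a1 b1) (crossing v a1 b2) (crossing v a1 b3)
  (crossing v a2 b1) (crossing v a2 b2) (crossing v a2 b3)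
  (crossing v a3 b1) (crossing v a3 b2) (crossing v a3 b3)); rewrite ?cr ?rat //;
  by [apply: star_independent a1S a2S a12|apply: star_independent a2S a3S a23
     |apply: star_independent a3S a1S a31|apply: (crossing_collinear Fint start)].
Qed.
End SegmentFamilies.

From mathcomp Require Import mathcomp_extra boolp classical_sets functions.
From mathcomp Require Import cardinality reals ereal esum fsbigop finmap.

(** * Segment hypergraphs *)

Lemma seq_int_min (s : seq int) : s != [::] ->
  exists2 m, m \in s & {in s, forall x, m <= x}.
Proof.
elim: s => // a s IHs _; have [->|/IHs[m ms mmin]] := eqVneq s [::].
  by exists a; [rewrite mem_head|move=> x; rewrite mem_seq1 => /eqP->].
have [am|ma] := leP a m.
  exists a; rewrite ?mem_head // => x; rewrite inE => /predU1P[->//|/mmin].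
  exact: le_trans.
exists m; first by rewrite inE ms orbT.
by move=> x; rewrite inE => /predU1P[->|/mmin//]; apply: ltW.
Qed.

(** The list is a permutation of the interval from its least to its greatest entry, so its size
    fixes the upper end. *)
Lemma convex_seq_int (s : seq int) : uniq s -> s != [::] ->
    (forall a b c, a \in s -> c \in s -> a <= b <= c -> b \in s) ->
  exists m, forall k, (k \in s) = (m <= k < m + (size s)%:Z).
Proof.
move=> us s0 conv; have [m ms mmin] := seq_int_min s0.
have [|M' + M'min] := @seq_int_min (map -%R s); first by case: (s) s0.
case/mapP => M Ms M'E; have Mmax : {in s, forall x, x <= M}.
  by move=> x xs; rewrite -lerN2 -M'E M'min // map_f.
have sE k : (k \in s) = (m <= k <= M).
  apply/idP/idP => [ks|]; first by rewrite mmin // Mmax.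
  exact: conv.
have mM := mmin _ Ms.
pose t := [seq m + i%:Z | i <- iota 0 `|M - m|.+1].
have /perm_size : perm_eq s t.
  apply: uniq_perm => // [|k].
    by rewrite map_inj_uniq ?iota_uniq // => i j; lia.
  rewrite sE; apply/idP/mapP => [mkM|[i]].
    by exists `|k - m|%N; rewrite ?mem_iota; lia.
  by rewrite mem_iota => + ->; lia.
rewrite size_map size_iota => sz; exists m => k; rewrite sE sz; lia.
Qed.

(** Coprimality in Bezout form; the coefficients later serve to read off positions along a line of
    direction [d]. *)
Definition primitive (d : int * int) : Prop := exists u v : int, u * d.1 + v * d.2 = 1.

(** Divide by the gcd and choose the sign that makes the quotient lexicographically positive. *)
Lemma primitive_direction (a b : int) : (a, b) != (0, 0) ->
  exists d, [/\ lex_positive d, primitive d &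
    exists2 m : int, m != 0 & (a, b) = (m * d.1, m * d.2)].
Proof.
move=> ab0; have [u [v uv]] := Bezoutz a b.
have [a' aE] : exists a', a = a' * gcdz a b by apply/dvdzP/dvdz_gcdl.
have [b' bE] : exists b', b = b' * gcdz a b by apply/dvdzP/dvdz_gcdr.
have g0 : gcdz a b != 0 by move: ab0; rewrite gcdz_eq0 xpair_eqE.
have uv1 : u * a' + v * b' = 1.
  by apply: (mulIf g0); rewrite mul1r mulrDl -!mulrA -aE -bE.
have [pos|neg] := boolP (lex_positive (a', b')).
  exists (a', b'); split => //=; first by exists u, v.
  by exists (gcdz a b) => //; rewrite ![gcdz a b * _]mulrC -aE -bE.
exists (- a', - b'); split => /=.
- move: neg uv1; rewrite /lex_positive /=.
  by have [->|?] := eqVneq a' 0; have [->|?] := eqVneq b' 0; lia.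
- by exists (- u), (- v) => /=; lia.
- by exists (- gcdz a b); rewrite ?oppr_eq0 //= !mulrNN ![gcdz a b * _]mulrC -aE -bE.
Qed.

Definition segment (r : nat) (p d : int * int) (e : set (int * int)) : Prop :=
  forall z, e z <-> exists2 k, (k < r)%N & z = step p d k.

Section SegmentForm.
Variables (R : realType) (r : nat).
Hypothesis r_ge3 : (3 <= r)%N.

(** Two points of [e] determine a primitive direction [d] of [L]. In the resulting integer
    coordinate, consecutiveness says that [e] is convex, so it is an interval of [r] integers. *)
Lemma segment_form (L : set (R * R)) (e : set (int * int)) :
    is_line L -> consecutive_on r L e ->
  exists p d, [/\ lex_positive d, primitive d & segment r p d e].
Proof.
move=> [a [b [c [ab0 LE]]]] [er eL econv].
have : finite_set e by apply/finite_setP; exists r.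
case/finite_fsetP => F eE; move: er; rewrite {1}eE => /card_eq_fsetP cF.
have eF z : e z <-> z \in F by rewrite eE.
have [p [q [pF qF pq]]] : exists p q, [/\ p \in F, q \in F & p != q].
  have sz1 : (1 < size F)%N by rewrite cF ltnW.
  exists (nth (0, 0) F 0), (nth (0, 0) F 1); rewrite !mem_nth ?(ltnW sz1) //.
  by rewrite nth_uniq // ltnW.
have [|d [dpos dprim [m m0 [qp1 qp2]]]] := @primitive_direction (q.1 - p.1) (q.2 - p.2).
  apply: contra pq => /eqP[] /eqP; rewrite subr_eq0 => /eqP h1 /eqP.
  by rewrite subr_eq0 => /eqP h2; rewrite [p]surjective_pairing [q]surjective_pairing h1 h2.
have inL z : e z -> a * (z.1)%:~R + b * (z.2)%:~R = c.
  by move=> ez; have : L (plane_pt R z) by [apply: eL; exists z]; rewrite LE.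
have orth : a * (d.1)%:~R + b * (d.2)%:~R = 0.
  have mR : m%:~R != 0 :> R by rewrite intr_eq0.
  apply: (mulfI mR); rewrite mulr0.
  have [h1 h2] : (q.1)%:~R = (p.1)%:~R + m%:~R * (d.1)%:~R :> R /\
      (q.2)%:~R = (p.2)%:~R + m%:~R * (d.2)%:~R :> R.
    by rewrite -!intrM -!intrD -qp1 -qp2 ![_ + (_ - _)]addrC !subrK.
  have := inL _ (iffRL (eF p) pF); have := inL _ (iffRL (eF q) qF).
  by rewrite h1 h2 => <- E; lra.
have onL k : L (plane_pt R (p.1 + k * d.1, p.2 + k * d.2)).
  rewrite LE /=; transitivity (c + k%:~R * (a * (d.1)%:~R + b * (d.2)%:~R)).
    by rewrite -(inL _ (iffRL (eF p) pF)) !intrD !intrM; ring.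
  by rewrite orth mulr0 addr0.
have [u [v uv]] := dprim.
(* The Bezout coefficients of [d] give an integer coordinate along the line, with origin [p] and
   unit [d]. *)
pose k (z : int * int) := u * (z.1 - p.1) + v * (z.2 - p.2).
have kE z : e z -> z = (p.1 + k z * d.1, p.2 + k z * d.2).
  (* Both [z - p] and [d] are orthogonal to the nonzero normal [(a, b)], hence parallel. *)
  move=> ez; have c0 : (z.1 - p.1) * d.2 - (z.2 - p.2) * d.1 = 0.
    apply/eqP; rewrite -(intr_eq0 R) intrB !intrM !intrB; apply/eqP.
    have := inL _ ez; rewrite -(inL _ (iffRL (eF p) pF)) => h.
    move: orth h; rewrite -!(intrB R).
    move: ab0; rewrite xpair_eqE negb_and.
    set x : R := (z.1)%:~R; set y : R := (z.2)%:~R.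
    set x' : R := (p.1)%:~R; set y' : R := (p.2)%:~R.
    set d1 : R := (d.1)%:~R; set d2 : R := (d.2)%:~R => nz o1 o2.
    have o3 : a * (x - x') + b * (y - y') = 0 by lra.
    case/orP: nz => [a0|b0]; [apply: (mulfI a0)|apply: (mulfI b0)]; rewrite mulr0.
      transitivity (d2 * (a * (x - x') + b * (y - y')) - (y - y') * (a * d1 + b * d2)).
        by ring.
      by rewrite o1 o3 !mulr0 subrr.
    transitivity ((x - x') * (a * d1 + b * d2) - d1 * (a * (x - x') + b * (y - y'))).
      by ring.
    by rewrite o1 o3 !mulr0 subrr.
  rewrite [LHS]surjective_pairing /k; congr pair.
    transitivity (p.1 + (z.1 - p.1) * (u * d.1 + v * d.2)); first by rewrite uv; ring.
    transitivity (p.1 + (u * (z.1 - p.1) + v * (z.2 - p.2)) * d.1 +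
      v * ((z.1 - p.1) * d.2 - (z.2 - p.2) * d.1)); first by ring.
    by rewrite c0 mulr0 addr0.
  transitivity (p.2 + (z.2 - p.2) * (u * d.1 + v * d.2)); first by rewrite uv; ring.
  transitivity (p.2 + (u * (z.1 - p.1) + v * (z.2 - p.2)) * d.2 -
    u * ((z.1 - p.1) * d.2 - (z.2 - p.2) * d.1)); first by ring.
  by rewrite c0 mulr0 subr0.
have kK j : k (p.1 + j * d.1, p.2 + j * d.2) = j.
  by transitivity (j * (u * d.1 + v * d.2)); [rewrite /k /=; ring|rewrite uv mulr1].
have inK j : (j \in map k F) = ((p.1 + j * d.1, p.2 + j * d.2) \in F).
  apply/mapP/idP => [[z zF ->]|jF]; first by rewrite -kE //; apply/eF.
  by eexists; [exact: jF|rewrite kK].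
have uK : uniq (map k F).
  rewrite map_inj_in_uniq ?fset_uniq // => x y /eF ex /eF ey kxy.
  by rewrite (kE _ ex) (kE _ ey) kxy.
have [||m1 Km1] := @convex_seq_int (map k F) uK.
- by rewrite -size_eq0 size_map cF -lt0n (leq_trans _ r_ge3).
- move=> x y z; rewrite !inK => /eF ex /eF ez /andP[xy yz]; apply/eF.
  apply: econv ex ez (onL y) _.
  (* For coinciding endpoints the quotient used below as parameter has denominator 0, so this case
     is separate. *)
  have [xz|xz] := eqVneq x z.
    have -> : y = x by lia.
    by exists 0; rewrite lexx ler01 /= !subr0 !mul0r !mul1r !addr0.
  have zx0 : 0 < z%:~R - x%:~R :> R
    by rewrite -intrB ltr0z subr_gt0 lt_def eq_sym xz (le_trans xy).
  exists ((y%:~R - x%:~R) / (z%:~R - x%:~R)); split.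
  - rewrite ler_pdivlMr // ler_pdivrMr // mul0r mul1r subr_ge0 ler_int xy /=.
    by rewrite lerD2r ler_int.
  - by rewrite /= !intrD !intrM; field; rewrite gt_eqF.
  - by rewrite /= !intrD !intrM; field; rewrite gt_eqF.
exists (p.1 + m1 * d.1, p.2 + m1 * d.2), d; split => // z.
rewrite size_map cF in Km1; split => [ez|[j jr ->]].
  have : k z \in map k F by apply/map_f/eF.
  rewrite Km1 => kz; exists `|k z - m1|%N; first by lia.
  rewrite {1}(kE _ ez) /step /=; have -> : `|k z - m1|%:Z = k z - m1 by lia.
  by congr pair; ring.
apply/eF; have : m1 + j%:Z \in map k F by rewrite Km1; lia.
by rewrite inK /step /= !mulrDl !addrA.
Qed.
End SegmentForm.

(** * A colouring of the integer points modulo 3 *)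

Definition color (z : int * int) : nat := `|((z.1 * z.1 + z.2 * z.2) %% 3)%Z|%N.

Lemma color_lt3 z : (color z < 3)%N.
Proof. by rewrite /color; lia. Qed.

Lemma color_eq z z' : color z = color z' ->
  exists m : int, z'.1 * z'.1 + z'.2 * z'.2 = z.1 * z.1 + z.2 * z.2 + 3 * m.
Proof.
rewrite /color; set A := _ + _; set B := z'.1 * _ + _ => AB.
by exists ((B %/ 3)%Z - (A %/ 3)%Z); lia.
Qed.

(* The second difference of [x ^ 2 + y ^ 2] along [d] is twice its value at [d],
   and this form is anisotropic modulo 3. *)
Lemma color_not_constant p d : primitive d ->
  color (step p d 0) = color (step p d 1) ->
  color (step p d 0) = color (step p d 2) -> False.
Proof.
case: p d => [x y] [a b] [u [v /= uv]]; rewrite /step /= !mul0r !addr0 => c1 c2.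
have [m1 /= h1] := color_eq c1; have [m2 /= h2] := color_eq c2.
(* The second difference gives [2 * (a * a + b * b) = 3 * (m2 - 2 * m1)]; subtracting this from
   three times the form yields the witness. *)
have [m mE] : exists m : int, a * a + b * b = 3 * m
  by exists (a * a + b * b - m2 + 2 * m1); lra.
have [a3 b3] : (exists a', a = 3 * a') /\ (exists b', b = 3 * b').
  have mod3 (n : int) : exists k, n = 3 * k \/ n = 3 * k + 1 \/ n = 3 * k + 2.
    by exists (n %/ 3)%Z; lia.
  have [i iE] := mod3 a; have [j jE] := mod3 b.
  case: iE => [|[]] iE; case: jE => [|[]] jE; move: mE; rewrite iE jE => mE;
    split; try (by exists i); try (by exists j); exfalso; lia.
case: a3 b3 uv => a' -> [b' ->] uv.
have : 3 * (u * a' + v * b') = u * (3 * a') + v * (3 * b') by ring.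
by rewrite uv; lia.
Qed.

(** * Finite families of segments *)

Section FiniteFamilies.
Local Open Scope classical_set_scope.
Variables (R : realType) (r : nat) (E0 : set (set (int * int))).
Variables (p d : set (int * int) -> int * int).
Hypothesis r_ge3 : (3 <= r)%N.
Hypothesis segE : forall e, E0 e -> segment r (p e) (d e) e.
Hypothesis d_pos : forall e, E0 e -> lex_positive (d e).
Hypothesis d_prim : forall e, E0 e -> primitive (d e).
Hypothesis d_inj : forall e e' z, E0 e -> E0 e' -> e z -> e' z ->
  cross (d e) (d e') = 0 -> e = e'.

(** This bound and [fractional_bound] test finite lists only, so infinite families can be handled
    without infinite sums. *)
Definition matching_bound (E : set (set (int * int))) (n : nat) : Prop :=
  forall M : seq (set (int * int)), uniq M -> {in M, forall e, E e} ->
    {in M &, forall e e', e `&` e' !=set0 -> e = e'} -> (size M <= n)%N.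

Definition fractional_bound (E : set (set (int * int))) (N : R) : Prop :=
  forall (s : seq (set (int * int))) (w : set (int * int) -> R),
    uniq s -> {in s, forall e, E e} -> (forall e, 0 <= w e) ->
    (forall z, \sum_(e <- s | `[< e z >]) w e <= 1) -> \sum_(e <- s) w e <= N.

Section Family.
Variable s : seq (set (int * int)).
Hypothesis s_uniq : uniq s.
Hypothesis sE0 : {in s, forall e, E0 e}.

Let points (e : set (int * int)) : seq (int * int) :=
  [seq step (p e) (d e) k | k <- iota 0 r].

Let xs : seq (int * int) := undup (flatten [seq points e | e <- s]).

(** Edges and points are replaced by their positions in lists, so that the results over finite types
    apply. *)
Let I : finType := 'I_(size s).
Let V : finType := 'I_(size xs).
Let edge (i : I) : set (int * int) := nth set0 s i.
Let pt (v : V) : int * int := nth (0, 0) xs v.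
Let inc (i : I) : {set V} := [set v | pt v \in points (edge i)].

Let edge_mem i : edge i \in s. Proof. exact: mem_nth. Qed.
Let edgeE i : E0 (edge i). Proof. exact: sE0. Qed.

Let edge_surj e : e \in s -> exists i, edge i = e.
Proof.
move=> es; have lt : (index e s < size s)%N by rewrite index_mem.
by exists (Ordinal lt); rewrite /edge /= nth_index.
Qed.

Let edge_inj : injective edge.
Proof. by move=> i j /eqP; rewrite nth_uniq // => /eqP/val_inj. Qed.

Let pt_inj : injective pt.
Proof. by move=> i j /eqP; rewrite nth_uniq ?undup_uniq // => /eqP/val_inj. Qed.

Let pointsP e z : E0 e -> reflect (e z) (z \in points e).
Proof.
move=> eE; apply: (iffP mapP) => [[k + ->]|].
  by rewrite mem_iota => kr; apply/(segE eE); exists k.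
by case/(segE eE) => k kr ->; exists k; rewrite ?mem_iota.
Qed.

Let incP i v : reflect (edge i (pt v)) (v \in inc i).
Proof. by rewrite inE; apply: pointsP. Qed.

Let pt_surj e z : e \in s -> e z -> exists v, pt v = z.
Proof.
move=> es ez; have zx : z \in xs.
  rewrite mem_undup; apply/flattenP; exists (points e); first exact: map_f.
  by apply/pointsP => //; apply: sE0.
have lt : (index z xs < size xs)%N by rewrite index_mem.
by exists (Ordinal lt); rewrite /pt /= nth_index.
Qed.

Let step_inc i k : (k < r)%N ->
  exists2 v, v \in inc i & pt v = step (p (edge i)) (d (edge i)) k.
Proof.
move=> kr; have ek : edge i (step (p (edge i)) (d (edge i)) k).
  by apply/(segE (edgeE i)); exists k.
have [v vE] := pt_surj (edge_mem i) ek.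
by exists v => //; apply/incP; rewrite vE.
Qed.

Let inc_step i v : v \in inc i ->
  exists2 k, (k < r)%N & pt v = step (p (edge i)) (d (edge i)) k.
Proof. by move/incP/(segE (edgeE i)). Qed.

Let card_inc i : #|inc i| = r.
Proof.
pose f (k : 'I_r) := sval (cid2 (step_inc i (ltn_ord k))).
have fP k : f k \in inc i /\ pt (f k) = step (p (edge i)) (d (edge i)) k.
  by rewrite /f; case: cid2.
have finj : injective f.
  move=> k k' /(congr1 pt); rewrite !(fP _).2 => -[].
  have := d_pos (edgeE i); rewrite /lex_positive => dp h1 h2; apply: val_inj => /=.
  by case/orP: dp => [|/andP[_]]; nia.
rewrite -[RHS](card_ord r) -(card_imset _ finj); apply: eq_card => v.
apply/idP/imsetP => [/inc_step[k kr vE]|[k _ ->]]; last exact: (fP k).1.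
by exists (Ordinal kr) => //; apply: pt_inj; rewrite vE (fP _).2.
Qed.

Let no_dense_intersecting (G : {set I}) : intersecting inc G ->
  (forall v, (degree inc G v <= r)%N) -> (#|G| < r * (r - 1))%N.
Proof.
apply: (@card_intersecting I V inc r pt (p \o edge) (d \o edge)) => //.
- by move=> i; apply: d_pos.
- move=> i j v /incP vi /incP vj c0; apply: edge_inj.
  exact: (@d_inj _ _ _ (edgeE i) (edgeE j) vi vj c0).
Qed.

Let sum_edges (P : pred (set (int * int))) (w : set (int * int) -> R) :
  \sum_(e <- s | P e) w e = \sum_(i : I | P (edge i)) w (edge i).
Proof. by rewrite (big_nth set0) big_mkord. Qed.

Let sum_points (P : pred (int * int)) (g : int * int -> R) :
  \sum_(z <- xs | P z) g z = \sum_(v : V | P (pt v)) g (pt v).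
Proof. by rewrite (big_nth (0, 0)) big_mkord. Qed.

Let xsP z : z \in xs -> exists2 e, e \in s & e z.
Proof.
rewrite mem_undup => /flattenP[_ /mapP[e es ->] /pointsP ez].
by exists e => //; apply: ez; apply: sE0.
Qed.

(** By [nu_bound] every fractional matching has weight at most [(r - 1) * n]; duality provides the
    cover, which is extended by 0 outside the points of the family. *)
Lemma finite_fractional_cover (n : nat) : matching_bound [set` s] n ->
  exists (X : seq (int * int)) (g : int * int -> R),
    [/\ uniq X, forall z, z \in X -> exists2 e, e \in s & e z,
        forall z, 0 <= g z /\ (z \notin X -> g z = 0),
        {in s, forall e, 1 <= \sum_(z <- X | `[< e z >]) g z} &
        \sum_(z <- X) g z <= (r%:R - 1) * n%:R].
Proof.
move=> sn; have r_ge2 := ltnW r_ge3.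
have [||g [g0 gcov gsum]] := @fractional_cover_of_matching_bound R I V inc ((r%:R - 1) * n%:R).
- by move=> i; rewrite -card_gt0 card_inc (leq_trans _ r_ge2).
- move=> w w0 w1; have := @nu_bound R I V inc r card_inc r_ge2 [set: I] w no_dense_intersecting.
  rewrite (eq_bigl xpredT) => [|i]; last by rewrite inE.
  move=> /(_ _)/le_trans -> //.
    split=> // v; rewrite /load (eq_bigl (fun i => v \in inc i)) // => i.
    by rewrite inE.
  rewrite ler_wpM2l ?subr_ge0 ?ler1n ?(leq_trans _ r_ge2) // ler_nat.
  have [M [_ dM <-]] := nu_attained inc [set: I].
  have := sn [seq edge i | i in M]; rewrite size_map -cardE; apply.
  + by rewrite map_inj_uniq ?enum_uniq.
  + by move=> _ /mapP[i _ ->]; apply: edge_mem.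
  + move=> _ _ /mapP[i + ->] /mapP[j + ->]; rewrite !mem_enum => iM jM [z [zi zj]].
    congr edge; apply: (disjoint_edgesP _ _ dM) => //; apply/set0Pn.
    have [v vz] := pt_surj (edge_mem i) zi.
    by exists v; rewrite inE; apply/andP; split; apply/incP; rewrite vz.
pose g' z := \sum_(v | pt v == z) g v.
have g'E v : g' (pt v) = g v.
  by rewrite /g' (eq_bigl (pred1 v)) ?big_pred1_eq // => v'; rewrite (inj_eq pt_inj).
exists xs, g'; split.
- exact: undup_uniq.
- exact: xsP.
- move=> z; split=> [|zx]; first exact: sumr_ge0.
  rewrite /g' big1 // => v /eqP vz.
  by case/negP: zx; rewrite -vz mem_nth.
- move=> e /edge_surj[i <-].
  rewrite sum_points; apply: le_trans (gcov i) _.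
  rewrite le_eqVlt; apply/orP; left; apply/eqP; apply: eq_big => [v|v _]; last by rewrite g'E.
  by apply/incP/asboolP.
- rewrite sum_points; apply: le_trans gsum; rewrite le_eqVlt; apply/orP; left; apply/eqP.
  by apply: eq_bigr => v _; apply: g'E.
Qed.

(** Duality gives a fractional cover of weight at most [N], and [rounding] makes it integral at the
    cost of a factor [r - 1]. *)
Lemma finite_cover (N : R) : fractional_bound [set` s] N ->
  exists X : seq (int * int),
    [/\ uniq X, forall z, z \in X -> exists2 e, e \in s & e z,
        {in s, forall e, exists2 z, z \in X & e z} &
        (size X)%:R <= (r%:R - 1) * N].
Proof.
move=> sN; have r_ge2 := ltnW r_ge3.
have [||g [g0 gcov gsum]] := @fractional_cover_of_matching_bound R I V inc N.
- by move=> i; rewrite -card_gt0 card_inc (leq_trans _ r_ge2).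
- move=> w w0 w1; pose w' e := \sum_(i | edge i == e) w i.
  have w'E i : w' (edge i) = w i.
    by rewrite /w' (eq_bigl (pred1 i)) ?big_pred1_eq // => j; rewrite (inj_eq edge_inj).
  have := sN s w' s_uniq; rewrite sum_edges (eq_bigr w) => [|i _]; last exact: w'E.
  apply=> // [e|z]; first exact: sumr_ge0.
  rewrite sum_edges (eq_bigr w) => [|i _]; last exact: w'E.
  have [/existsP[v /eqP vz]|/existsPn noz] := boolP [exists v, pt v == z].
    apply: le_trans (w1 v); rewrite le_eqVlt; apply/orP; left; apply/eqP.
    by apply: eq_bigl => i; rewrite -vz; apply/asboolP/incP.
  rewrite big1 // => i /asboolP /(pt_surj (edge_mem i))[v /eqP].
  by rewrite (negPf (noz v)).
(* The three colours are viewed among the [r] colours that [rounding] expects; an edge contains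
   three consecutive points, which do not all share a colour. *)
pose col (v : V) : 'I_r := Ordinal (leq_trans (color_lt3 (pt v)) r_ge3).
have col_inc i (c : 'I_r) : exists2 v, v \in inc i & col v != c.
  have [/exists_inP//|/exists_inPn mono] := boolP [exists v in inc i, col v != c].
  have colE k : (k < r)%N -> color (step (p (edge i)) (d (edge i)) k) = c.
    move=> /(step_inc i)[v vi <-]; have := mono v vi.
    by rewrite negbK => /eqP <-.
  exfalso; apply: (color_not_constant (p := p (edge i)) (d_prim (edgeE i)));
    by rewrite !colE // ?(leq_trans _ r_ge3).
have [C [Ccov Ccard]] := @rounding R I V inc r col g card_inc r_ge2 col_inc g0 gcov.
exists [seq pt v | v in C]; split.
- by rewrite map_inj_uniq ?enum_uniq.
- by move=> _ /mapP[v _ ->]; apply: xsP; apply: mem_nth.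
- move=> e /edge_surj[i <-].
  have /set0Pn[v] := Ccov i; rewrite inE => /andP[/incP ve vC].
  by exists (pt v); rewrite // map_f // mem_enum.
- rewrite size_map -cardE (le_trans Ccard) // ler_wpM2l //.
  by rewrite subr_ge0 ler1n (leq_trans _ r_ge2).
Qed.
End Family.
End FiniteFamilies.

(** * Removing vertices of infinite degree *)

Section ArbitraryFamilies.
Local Open Scope classical_set_scope.
Variables (R : realType) (r : nat) (E0 : set (set (int * int))).
Variables (p d : set (int * int) -> int * int).
Implicit Types (E : set (set (int * int))) (z : int * int).
Hypothesis r_ge3 : (3 <= r)%N.
Hypothesis segE : forall e, E0 e -> segment r (p e) (d e) e.
Hypothesis d_pos : forall e, E0 e -> lex_positive (d e).
Hypothesis d_prim : forall e, E0 e -> primitive (d e).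
Hypothesis d_inj : forall e e' z, E0 e -> E0 e' -> e z -> e' z ->
  cross (d e) (d e') = 0 -> e = e'.

(** Both directions are parallel to the nonzero difference of the two points. *)
Lemma edge_eq_of_two_points e e' z z' :
    E0 e -> E0 e' -> z != z' -> e z -> e z' -> e' z -> e' z' ->
  e = e'.
Proof.
move=> eE e'E zz' ez ez' e'z e'z'; apply: (d_inj eE e'E ez e'z).
have [i _ iE] := (iffLR (segE eE z)) ez; have [j _ jE] := (iffLR (segE eE z')) ez'.
have [k _ kE] := (iffLR (segE e'E z)) e'z; have [l _ lE] := (iffLR (segE e'E z')) e'z'.
move: zz' iE jE kE lE; rewrite /cross /step.
case: z z' (p e) (p e') (d e) (d e') {ez ez' e'z e'z'}
  => [z1 z2] [z1' z2'] [p1 p2] [q1 q2] [a b] [a' b'] /=.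
rewrite xpair_eqE negb_and => zz' [i1 i2] [j1 j2] [k1 k2] [l1 l2].
have x1 : z1 - z1' = (i%:Z - j%:Z) * a by rewrite i1 j1; ring.
have x2 : z2 - z2' = (i%:Z - j%:Z) * b by rewrite i2 j2; ring.
have y1 : z1 - z1' = (k%:Z - l%:Z) * a' by rewrite k1 l1; ring.
have y2 : z2 - z2' = (k%:Z - l%:Z) * b' by rewrite k2 l2; ring.
have ij : i%:Z - j%:Z != 0.
  by apply: contraTneq zz' => ij; move: x1 x2; rewrite ij !mul0r; lia.
have kl : k%:Z - l%:Z != 0.
  by apply: contraTneq zz' => kl; move: y1 y2; rewrite kl !mul0r; lia.
apply: (mulfI ij); apply: (mulfI kl); rewrite !mulr0.
transitivity ((i%:Z - j%:Z) * a * ((k%:Z - l%:Z) * b') -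
  (i%:Z - j%:Z) * b * ((k%:Z - l%:Z) * a')).
  by ring.
by rewrite -x1 -x2 -y1 -y2; ring.
Qed.

Lemma edge_finite e : E0 e -> finite_set e.
Proof.
move=> eE; apply: (sub_finite_set _ (finite_seq [seq step (p e) (d e) k | k <- iota 0 r])).
by move=> z /(segE eE)[k kr ->] /=; apply: map_f; rewrite mem_iota.
Qed.

Definition at_vertex E z : set (set (int * int)) := [set e | E e /\ e z].
Definition off_vertex E z : set (set (int * int)) := [set e | E e /\ ~ e z].

(** The edges of [s] cover finitely many points, all different from [v], and each of these lies on
    at most one edge through [v]. *)
Lemma fresh_edge E v (s : seq (set (int * int))) : E `<=` E0 ->
    infinite_set (at_vertex E v) -> {in s, forall f, E0 f /\ ~ f v} ->
  exists e, at_vertex E v e /\ {in s, forall f, ~ (e `&` f !=set0)}.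
Proof.
move=> EE0 inf sE; apply: contrapT => no; apply: inf.
pose U : set (int * int) := \bigcup_(f in [set` s]) f.
have finU : finite_set U.
  by apply: bigcup_finite; [exact: finite_seq|move=> f /= /sE[/edge_finite]].
apply: (@sub_finite_set _ _ (\bigcup_(u in U) [set e | at_vertex E v e /\ e u])).
  move=> e ev; apply: contrapT => eU; apply: no; exists e; split=> // f fs [u [eu fu]].
  by apply: eU; exists u; [exists f|].
apply: bigcup_finite => // u [f /= /sE[fE fv] fu].
have vu : v != u by apply/eqP => vu; apply: fv; rewrite vu.
have [[e0 [[e0E e0v] e0u]]|none] := pselect (exists e, at_vertex E v e /\ e u).
  apply: (sub_finite_set _ (finite_set1 e0)) => e [[eE ev] eu] /=.
  exact: (edge_eq_of_two_points (EE0 _ eE) (EE0 _ e0E) vu).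
by apply: (sub_finite_set _ (finite_set0 _)) => e eu; apply: none; exists e.
Qed.

Lemma maximum_matching E n : matching_bound E n ->
  exists M : seq (set (int * int)), [/\ uniq M, {in M, forall e, E e},
    {in M &, forall e e', e `&` e' !=set0 -> e = e'} & matching_bound E (size M)].
Proof.
move=> En; pose good (k : nat) := `[< exists M : seq (set (int * int)),
  [/\ uniq M, {in M, forall e, E e},
    {in M &, forall e e', e `&` e' !=set0 -> e = e'} & size M = k] >].
have good0 : exists k, good k by exists 0%N; apply/asboolP; exists [::].
have goodn k : good k -> (k <= n)%N.
  by move=> /asboolP[M [uM ME dM <-]]; apply: En.
case: (ex_maxnP good0 goodn) => k /asboolP[M [uM ME dM szM]] kmax.
exists M; split=> // M' uM' M'E dM'; rewrite szM; apply: kmax.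
by apply/asboolP; exists M'.
Qed.

(** Every edge meets the finite point set covered by a maximum matching. *)
Lemma finite_of_finite_degrees E n : E `<=` E0 -> matching_bound E n ->
  (forall z, finite_set (at_vertex E z)) -> finite_set E.
Proof.
move=> EE0 En deg.
have [M [uM ME dM Mmax]] := maximum_matching En.
pose U : set (int * int) := \bigcup_(f in [set` M]) f.
have finU : finite_set U.
  by apply: bigcup_finite; [exact: finite_seq|move=> f /= /ME /EE0 /edge_finite].
apply: (@sub_finite_set _ _ (\bigcup_(u in U) at_vertex E u)); last exact: bigcup_finite.
move=> e eE; apply: contrapT => eU.
have nM f : f \in M -> ~ (e `&` f !=set0).
  by move=> fM [u [eu fu]]; apply: eU; exists u => //; exists f.
have e0 : e !=set0.
  exists (step (p e) (d e) 0); apply/(segE (EE0 _ eE)).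
  by exists 0%N; rewrite ?(leq_trans _ r_ge3).
suff /= : (size (e :: M) <= size M)%N by rewrite ltnn.
apply: (Mmax (e :: M)) => /=.
- rewrite uM andbT; apply/negP => eM; apply: (nM _ eM); rewrite setIid.
  exact: e0.
- by move=> f; rewrite inE => /predU1P[->|/ME].
- move=> f f'; rewrite !inE => /predU1P[->|fM] /predU1P[->|f'M] //.
  + by move/(nM _ f'M).
  + by rewrite setIC => /(nM _ fM).
  + exact: dM.
Qed.

Lemma finite_family E n : E `<=` E0 -> matching_bound E n ->
    ~ (exists v, infinite_set (at_vertex E v)) ->
  exists s, uniq s /\ [set` s] = E.
Proof.
move=> EE0 En nov; have : finite_set E.
  apply: (finite_of_finite_degrees EE0 En) => z.
  by apply: contrapT => inf; apply: nov; exists z.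
case/finite_fsetP => F EF; exists F; split; first exact: fset_uniq.
by rewrite EF.
Qed.

(** A matching that avoids [v] can be enlarged by a fresh edge at [v]; the empty matching gives
    [0 < n]. *)
Lemma matching_bound_off E v n : E `<=` E0 -> infinite_set (at_vertex E v) ->
  matching_bound E n -> (0 < n)%N /\ matching_bound (off_vertex E v) n.-1.
Proof.
move=> EE0 inf En.
have key M : uniq M -> {in M, forall e, off_vertex E v e} ->
    {in M &, forall e e', e `&` e' !=set0 -> e = e'} -> (size M < n)%N.
  move=> uM ME dM.
  have [|e [[eE ev] efresh]] := @fresh_edge E v M EE0 inf.
    by move=> f /ME[/EE0].
  apply: (En (e :: M)) => /=.
  - by rewrite uM andbT; apply/negP => /ME[_].
  - by move=> f; rewrite inE => /predU1P[->|/ME[]].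
  - move=> f f'; rewrite !inE => /predU1P[->|fM] /predU1P[->|f'M] //.
    + by move/(efresh _ f'M).
    + by rewrite setIC => /(efresh _ fM).
    + exact: dM.
have n0 : (0 < n)%N by apply: (key [::]).
by split=> // M uM ME dM; rewrite -ltnS prednK // key.
Qed.

(** A fresh edge at [v] meets no edge of the list, so it can carry weight 1 without overloading any
    vertex. *)
Lemma fractional_bound_off E v (N : R) : E `<=` E0 -> infinite_set (at_vertex E v) ->
  fractional_bound E N -> fractional_bound (off_vertex E v) (N - 1).
Proof.
move=> EE0 inf EN s w us sE w0 w1.
have [|e [[eE ev] efresh]] := @fresh_edge E v s EE0 inf.
  by move=> f /sE[/EE0].
have es : e \notin s by apply/negP => /sE[].
pose w' f := if f == e then 1 else w f.
have w'e : w' e = 1 by rewrite /w' eqxx.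
have w's (P : pred (set (int * int))) : \sum_(f <- s | P f) w' f = \sum_(f <- s | P f) w f.
  rewrite big_seq_cond [RHS]big_seq_cond; apply: eq_bigr => f /andP[fs _].
  by rewrite /w'; case: eqP => // fe; rewrite fe in fs; rewrite fs in es.
have := EN (e :: s) w'; rewrite big_cons w's w'e lerBrDl; apply => /=.
- by rewrite es.
- by move=> f; rewrite inE => /predU1P[->|/sE[]].
- by move=> f; rewrite /w'; case: eqP.
- move=> z; rewrite big_cons w's; case: asboolP => // ez.
  rewrite w'e big1_seq ?addr0 // => f /andP[/asboolP fz fs].
  by case: (efresh f fs); exists z.
Qed.

Let r1 : 1 <= r%:R - 1 :> R.
Proof. by rewrite lerBrDr -[1 + 1]/(2%:R) ler_nat ltnW. Qed.

(** Induction on [n]: a vertex of infinite degree receives weight 1, which the drop of [n] by 1 pays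
    for since [r - 1 >= 1]. Without such a vertex the family is finite. *)
Lemma fractional_cover_of_bound E n : E `<=` E0 -> matching_bound E n ->
  exists (X : seq (int * int)) (g : int * int -> R),
    [/\ uniq X, forall z, z \in X -> exists2 e, E e & e z,
        forall z, 0 <= g z /\ (z \notin X -> g z = 0),
        forall e, E e -> 1 <= \sum_(z <- X | `[< e z >]) g z &
        \sum_(z <- X) g z <= (r%:R - 1) * n%:R].
Proof.
have base k E' : E' `<=` E0 -> matching_bound E' k ->
    ~ (exists v, infinite_set (at_vertex E' v)) ->
  exists (X : seq (int * int)) (g : int * int -> R),
    [/\ uniq X, forall z, z \in X -> exists2 e, E' e & e z,
        forall z, 0 <= g z /\ (z \notin X -> g z = 0),
        forall e, E' e -> 1 <= \sum_(z <- X | `[< e z >]) g z &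
        \sum_(z <- X) g z <= (r%:R - 1) * k%:R].
  move=> E'E0 E'n nov; have [s [us sE']] := finite_family E'E0 E'n nov.
  have sE0 : {in s, forall e, E0 e} by move=> e es; apply: E'E0; rewrite -sE'.
  rewrite -sE' in E'n *.
  exact: (finite_fractional_cover R r_ge3 segE d_pos d_inj us sE0 E'n).
elim: n {-2}n (leqnn n) E => [|m IHm] n nm E EE0 En;
  have [[v inf]|nov] := pselect (exists v, infinite_set (at_vertex E v)).
- have [n0 _] := matching_bound_off EE0 inf En.
  by move: nm; rewrite leqNgt n0.
- exact: base.
- have [n0 En'] := matching_bound_off EE0 inf En.
  have offE0 : off_vertex E v `<=` E0 by move=> e [/EE0].
  have [|X [g [uX XE g0 gcov gsum]]] := IHm n.-1 _ _ offE0 En'.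
    by rewrite -ltnS prednK.
  have vX : v \notin X by apply/negP => /XE[e []].
  pose g' z := if z == v then 1 else g z.
  have g'v : g' v = 1 by rewrite /g' eqxx.
  have g'X (P : pred (int * int)) : \sum_(z <- X | P z) g' z = \sum_(z <- X | P z) g z.
    rewrite big_seq_cond [RHS]big_seq_cond; apply: eq_bigr => z /andP[zX _].
    by rewrite /g'; case: eqP => // zv; rewrite zv in zX; rewrite zX in vX.
  exists (v :: X), g'; split=> [|z|z|e eE|] /=; first by rewrite vX.
  + rewrite inE => /predU1P[->|/XE[e [eE _] ez]]; last by exists e.
    by apply: contrapT => no; apply: inf; apply: (sub_finite_set _ (finite_set0 _));
      move=> e [eE ev]; apply: no; exists e.
  + rewrite inE negb_or /g'; case: eqP => //= _; exact: g0.
  + rewrite big_cons g'v g'X; case: asboolP => ev; last by apply: gcov.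
    by rewrite lerDl; apply: sumr_ge0 => z _; case: (g0 z).
  + rewrite big_cons g'v g'X; apply: le_trans (lerD r1 gsum) _.
    by rewrite -[X in X + _]mulr1 -mulrDr nat1r prednK.
- exact: base.
Qed.

(** The same induction: [n] ensures that the deletions end, while each deleted vertex is paid for by
    a drop of [N] by 1. *)
Lemma cover_of_bound E n (N : R) :
    E `<=` E0 -> matching_bound E n -> fractional_bound E N ->
  exists X : seq (int * int),
    [/\ uniq X, forall z, z \in X -> exists2 e, E e & e z,
        forall e, E e -> exists2 z, z \in X & e z &
        (size X)%:R <= (r%:R - 1) * N].
Proof.
have base k E' (N' : R) : E' `<=` E0 -> matching_bound E' k -> fractional_bound E' N' ->
  ~ (exists v, infinite_set (at_vertex E' v)) ->
  exists X : seq (int * int),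
    [/\ uniq X, forall z, z \in X -> exists2 e, E' e & e z,
        forall e, E' e -> exists2 z, z \in X & e z &
        (size X)%:R <= (r%:R - 1) * N'].
  move=> E'E0 E'n E'N nov; have [s [us sE']] := finite_family E'E0 E'n nov.
  have sE0 : {in s, forall e, E0 e} by move=> e es; apply: E'E0; rewrite -sE'.
  rewrite -sE' in E'N *.
  exact: (finite_cover r_ge3 segE d_pos d_prim us sE0 E'N).
elim: n {-2}n (leqnn n) E N => [|m IHm] n nm E N EE0 En EN;
  have [[v inf]|nov] := pselect (exists v, infinite_set (at_vertex E v)).
- have [n0 _] := matching_bound_off EE0 inf En.
  by move: nm; rewrite leqNgt n0.
- exact: (base _ _ _ EE0 En EN nov).
- have [n0 En'] := matching_bound_off EE0 inf En.
  have EN' := fractional_bound_off EE0 inf EN.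
  have offE0 : off_vertex E v `<=` E0 by move=> e [/EE0].
  have [|X [uX XE Xcov Xsz]] := IHm n.-1 _ _ _ offE0 En' EN'.
    by rewrite -ltnS prednK.
  have vX : v \notin X by apply/negP => /XE[e []].
  exists (v :: X); split=> [|z|e eE|] /=; first by rewrite vX.
  + rewrite inE => /predU1P[->|/XE[e [eE _] ez]]; last by exists e.
    by apply: contrapT => no; apply: inf; apply: (sub_finite_set _ (finite_set0 _));
      move=> e [eE ev]; apply: no; exists e.
  + have [ev|ev] := pselect (e v); first by exists v; rewrite ?mem_head.
    by have [z zX ez] := Xcov e (conj eE ev); exists z; rewrite // inE zX orbT.
  + rewrite -nat1r; apply: le_trans (lerD r1 Xsz) _.
    by rewrite -[X in X + _]mulr1 -mulrDr [1 + _]addrC subrK.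
- exact: (base _ _ _ EE0 En EN nov).
Qed.
End ArbitraryFamilies.

(** * Passage to the extended-real matching and covering numbers *)

Section Numbers.
Local Open Scope classical_set_scope.
Local Open Scope card_scope.

Lemma esum_seq (R : realType) (T : choiceType) (A : set T) (s : seq T) (f : T -> R) :
    uniq s -> (forall z, 0 <= f z) -> (forall z, z \notin s -> f z = 0) ->
  (\esum_(z in A) (f z)%:E = (\sum_(z <- s | `[< A z >]) f z)%:E)%E.
Proof.
move=> us f0 fs; rewrite (esumID [set` s]) => [|z _]; last by rewrite lee_fin.
rewrite [X in (_ + X)%E]esum1 => [|z [_ /negP zs]]; last by rewrite fs.
rewrite adde0 (_ : A `&` _ = [set` [seq z <- s | `[< A z >]]]); last first.
  apply/seteqP; split=> z /=; rewrite mem_filter.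
    by case=> Az zs; apply/andP; split=> //; apply/asboolP.
  by case/andP=> /asboolP.
rewrite esum_fset => [||z _]; [|exact: finite_seq|by rewrite lee_fin].
by rewrite -fsbig_seq ?filter_uniq // big_filter sumEFin.
Qed.

Lemma card_eq_seq (T : choiceType) (s : seq T) : uniq s -> [set` s] #= `I_(size s).
Proof.
move=> us; have -> : [set` s] = [set` [fset x in s]%fset].
  by apply/seteqP; split=> x /=; rewrite inE.
by apply/card_eq_fsetP; rewrite card_fseq undup_id.
Qed.

Variables (R : realType) (r : nat) (H : hypergraph (int * int)).
Hypothesis r_ge3 : (3 <= r)%N.
Hypothesis hH : segment_hypergraph R r H.

(** For the last clause, two parallel edges through [z] lie on the line through [z] with normal
    [(d.2, - d.1)], which contains only one edge. *)
Lemma segment_hypergraph_forms : exists p d : set (int * int) -> int * int,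
  [/\ forall e, edges H e -> segment r (p e) (d e) e,
      forall e, edges H e -> lex_positive (d e),
      forall e, edges H e -> primitive (d e) &
      forall e e' z, edges H e -> edges H e' -> e z -> e' z ->
        cross (d e) (d e') = 0 -> e = e'].
Proof.
have [segH lineH] := hH.
have /choice[f fP] : forall e : set (int * int), exists pd : (int * int) * (int * int),
    edges H e -> [/\ lex_positive pd.2, primitive pd.2 & segment r pd.1 pd.2 e].
  move=> e; have [eH|neH] := pselect (edges H e); last by exists ((0, 0), (0, 0)).
  have [L Lline Le] := segH e eH.
  by have [p [d pdP]] := segment_form r_ge3 Lline Le; exists (p, d).
exists (fun e => (f e).1), (fun e => (f e).2); split=> [e /fP[]//|e /fP[]//|e /fP[]//|].
move=> e e' z eH e'H ez e'z c0.
have [dpos _ seg] := fP e eH; have [_ _ seg'] := fP e' e'H.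
pose a : R := ((f e).2.2)%:~R; pose b : R := - ((f e).2.1)%:~R.
pose L : set (R * R) := [set q | a * q.1 + b * q.2 = a * (z.1)%:~R + b * (z.2)%:~R].
have onL u v p d : cross (f e).2 d = 0 -> segment r p d u -> u z -> u v ->
    L (plane_pt R v).
  rewrite /L /plane_pt /a /b /= => cd su /su[k _ ->] /su[l _ ->]; rewrite /step /=.
  rewrite !mulNr -!intrM -!intrB; congr intmul.
  apply/eqP; rewrite -subr_eq0; apply/eqP.
  transitivity ((k%:Z - l%:Z) * cross (f e).2 d); first by rewrite /cross; ring.
  by rewrite cd mulr0.
apply: (lineH L) => //.
- exists a, b, (a * (z.1)%:~R + b * (z.2)%:~R); split=> //.
  rewrite xpair_eqE oppr_eq0 !intr_eq0; move: dpos; rewrite /lex_positive.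
  by move: (f e).2 => [e1 e2] /=; lia.
- by move=> _ [v ev <-]; apply: onL seg ez ev; rewrite /cross mulrC subrr.
- by move=> _ [v ev <-]; apply: onL seg' e'z ev.
Qed.

Lemma matching_number_ge (M : seq (set (int * int))) : uniq M ->
    {in M, forall e, edges H e} -> {in M &, forall e e', e `&` e' !=set0 -> e = e'} ->
  ((size M)%:R%:E <= matching_number R H)%E.
Proof.
move=> uM ME dM; apply: ereal_sup_ubound; exists [set` M], (size M).
split=> //; last exact: card_eq_seq.
Qed.

Lemma fractional_bound_number (N : R) : fractional_matching_number R H = N%:E ->
  fractional_bound (edges H) N.
Proof.
move=> NE s w us sE w0 w1; rewrite -lee_fin -NE.
pose f e := if e \in s then w e else 0.
have f0 e : 0 <= f e by rewrite /f; case: ifP.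
have fs e : e \notin s -> f e = 0 by rewrite /f => /negPf ->.
have fsum (P : pred (set (int * int))) : \sum_(e <- s | P e) f e = \sum_(e <- s | P e) w e.
  rewrite big_seq_cond [RHS]big_seq_cond; apply: eq_bigr => e /andP[es _].
  by rewrite /f es.
apply: ereal_sup_ubound; exists f.
  split=> // v _; rewrite (esum_seq _ us f0 fs) lee_fin fsum.
  apply: le_trans (w1 v); rewrite big_seq_cond [leRHS]big_seq_cond.
  rewrite le_eqVlt; apply/orP; left; apply/eqP; apply: eq_bigl => e.
  case es: (e \in s) => //=; apply/asboolP/asboolP => [[]//|ev].
  by split=> //; apply: sE.
rewrite (esum_seq _ us f0 fs) fsum big_seq_cond [in RHS]big_seq_cond; congr _%:E.
apply: eq_bigl => e; rewrite andbT; case es: (e \in s) => //=.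
by apply/esym/asboolP/sE.
Qed.

(** Weight 1 on each edge of a matching is a fractional matching, because at most one of its edges
    contains a given point. *)
Lemma matching_bound_of_fractional E (N : R) : fractional_bound E N ->
  matching_bound E (Num.bound N).
Proof.
move=> EN M uM ME dM; rewrite -(ler_nat R).
apply: le_trans (_ : N <= _); last first.
  have [N0|N0] := leP 0 N; first by rewrite ltW // archi_boundP.
  by rewrite (le_trans (ltW N0)).
have sum1 (s : seq (set (int * int))) : \sum_(e <- s) 1 = (size s)%:R :> R.
  by rewrite -sum1_size natr_sum.
have := EN M (fun=> 1) uM ME; rewrite sum1; apply=> // z.
rewrite -big_filter sum1 (ler_nat _ _ 1).
have := filter_uniq (fun e => `[< e z >]) uM.
have sub e : e \in [seq e <- M | `[< e z >]] -> e \in M /\ e z.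
  by rewrite mem_filter => /andP[/asboolP].
case: [seq _ <- _ | _] sub => [|e [|e' M']] // sub /=.
rewrite inE negb_or => /andP[/andP[/negP[]]].
have [eM ez] := sub e (mem_head _ _).
have [|e'M e'z] := sub e'; first by rewrite !inE eqxx orbT.
by apply/eqP; apply: dM => //; exists z.
Qed.
End Numbers.

Theorem theorem5p1 (R : realType) (r : nat) (H : hypergraph (int * int))
    (hr : (3 <= r)%N) (hH : segment_hypergraph R r H) :
  (fractional_covering_number R H <= (r%:R - 1)%:E * matching_number R H)%E /\
  (covering_number R H <= (r%:R - 1)%:E * fractional_matching_number R H)%E.
Proof.
have [p [d [segE d_pos d_prim d_inj]]] := segment_hypergraph_forms hr hH.
have r1 : 0 < r%:R - 1 :> R by rewrite subr_gt0 ltr1n ltnW.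
split.
  (* If matchings are arbitrarily large, [matching_number] is infinite and so is the right-hand
     side. *)
  have [[n Hn]|nobound] := pselect (exists n, matching_bound (edges H) n); last first.
    suff -> : matching_number R H = +oo%E by rewrite gt0_muley ?leey ?lte_fin.
    apply/eqyP => A A0; apply: le_trans (_ : ((Num.bound A)%:R%:E <= _)%E).
      by rewrite lee_fin ltW // archi_boundP // ltW.
    apply: contrapT => lt; apply: nobound; exists (Num.bound A) => M uM ME dM.
    rewrite leqNgt; apply/negP => ltM; apply: lt.
    by apply: le_trans (matching_number_ge R uM ME dM); rewrite lee_fin ler_nat ltnW.
  (* A maximum matching replaces the bound [n] by an attained one, which [matching_number]
     dominates. *)
  have [M [uM ME dM Mmax]] := maximum_matching Hn.
  have [X [g [uX XE g0 gcov gsum]]] :=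
    fractional_cover_of_bound R hr segE d_pos d_inj (@subset_refl _ _) Mmax.
  have gpos z : 0 <= g z by case: (g0 z).
  have gX z : z \notin X -> g z = 0 by case: (g0 z).
  apply: le_trans (_ : ((r%:R - 1)%:E * (size M)%:R%:E <= _)%E); last first.
    apply: lee_wpmul2l; first by rewrite lee_fin ltW.
    exact: (matching_number_ge R uM ME dM).
  apply: le_trans (_ : ((\sum_(z <- X) g z)%:E <= _)%E); last by rewrite -EFinM lee_fin.
  apply: ereal_inf_lbound; exists g.
    split=> // e eH; rewrite (esum_seq _ uX gpos gX) lee_fin.
    exact: gcov.
  rewrite (esum_seq _ uX gpos gX) [in RHS]big_seq_cond big_seq; congr _%:E.
  apply: eq_bigl => z; case zX: (z \in X) => //=; apply/esym/asboolP.
  by have [e eH ez] := XE z zX; apply: edges_sub eH _ ez.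
(* The zero weight excludes the value [-oo]; for [+oo] the right-hand side is infinite. *)
have fm0 : (0 <= fractional_matching_number R H)%E.
  apply: ereal_sup_ubound; exists (fun=> 0); last by rewrite esum1.
  by split=> // v _; rewrite esum1.
case NE : (fractional_matching_number R H) fm0 => [N| |] // _; last first.
  by rewrite gt0_muley ?leey ?lte_fin.
have fN := fractional_bound_number NE.
have [X [uX XE Xcov Xsz]] :=
  cover_of_bound hr segE d_pos d_prim d_inj (@subset_refl _ _)
    (matching_bound_of_fractional fN) fN.
apply: le_trans (_ : ((size X)%:R%:E <= _)%E); last by rewrite -EFinM lee_fin.
apply: ereal_inf_lbound; exists [set` X]%classic, (size X).
split=> //; last exact: card_eq_seq.
split=> [z /= /XE[e eH ez]|e /Xcov[z zX ez]]; first exact: edges_sub eH _ ez.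
by exists z.
Qed.
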